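(* Let $G$ be a unimodular connected Lie group with a smooth transitive right action on a smooth manifold $M$, suppose $M$ admits a nonzero $G$-invariant Radon measure $\nu$, and fix $p\in M$ with $\pi:G\to M$, $\pi(\sigma)=p\cdot\sigma$. If $G$ is uniformly doubling, then so is the family of metric measure spaces $$\left\{(M, d_{\pi_{*} g}, \nu) : g \text{ is a left-invariant Riemannian metric on } G \right\}.$$
   Context: For a metric measure space $(X,d,m)$, its volume doubling constant is $\sup_{x\in X,\,r>0} m(B(x,2r))/m(B(x,r))$, where $B(x,r)$ is the closed ball. A family of metric measure spaces is uniformly doubling if there is a single finite upper bound for all their doubling constants. $G$ is uniformly doubling if there is a finite constant bounding the doubling constants of $(G,d_g,\mu)$ for all left-invariant Riemannian metrics $g$ on $G$, where $d_g$ is the Riemannian distance and $\mu$ is a bi-invariant Haar measure on $G$. For a left-invariant Riemannian metric $g$ on $G$, $\pi_*g$ denotes the unique Riemannian metric on $M$ for which $\pi$ is a Riemannian submersion from $(G,g)$ (it exists and does not depend on $p$), and $d_{\pi_*g}$ is its Riemannian distance. The measure $\nu$ need not be the Riemannian volume of $\pi_*g$. *)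

(* Defs.v *)
From HB Require Import structures.
From mathcomp Require Import all_boot all_order all_algebra.
From mathcomp Require Import all_classical all_reals all_analysis.

Set Implicit Arguments.
Unset Strict Implicit.
Unset Printing Implicit Defensive.

Import Order.TTheory GRing.Theory Num.Theory.
Import numFieldNormedType.Exports.

Local Open Scope classical_set_scope.
Local Open Scope ring_scope.

(** * Smooth manifolds *)

(* [Ck k U f]: f is C^k on the open set U, by iterated directional
   derivatives.  For finite-dimensional V, the only case used below, this is
   the usual notion (all partial derivatives of order at most k exist and are
   continuous on U). *)
Fixpoint Ck {R : realType} {V W : normedModType R} (k : nat) (U : set V)
    (f : V -> W) : Prop :=
  (forall x, U x -> {for x, continuous f}) /\
  match k with
  | 0%N => True
  | k'.+1 => forall v : V,
      (forall x, U x -> derivable f x v) /\ Ck k' U (fun x => 'D_v f x)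
  end.

Definition smooth_on {R : realType} {V W : normedModType R} (U : set V)
  (f : V -> W) : Prop := forall k, Ck k U f.

(* A chart is given by total functions; the values of the coordinate map
   outside its domain, and of its inverse outside the image of the domain, are
   irrelevant. *)
Record chart (R : realType) (n : nat) (M : topologicalType) := Chart {
  chart_dom : set M;
  chart_map :> M -> 'rV[R]_n;
  chart_inv : 'rV[R]_n -> M;
  chart_dom_open : open chart_dom;
  chart_img_open : open (chart_map @` chart_dom);
  chart_mapK : forall x, chart_dom x -> chart_inv (chart_map x) = x;
  chart_map_continuous :
    forall x, chart_dom x -> {for x, continuous chart_map};
  chart_inv_continuous : forall u, (chart_map @` chart_dom) u ->
    {for u, continuous chart_inv} }.

Definition chart_img R n M (c : @chart R n M) : set 'rV[R]_n :=
  c @` chart_dom c.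

(* Manifolds are pointed (hence nonempty) only because the library attaches
   generated sigma-algebras to pointed types; the point itself plays no role. *)
HB.mixin Record isSmoothManifold (R : realType) (n : nat) M
    of PointedTopological M := {
  atlas : set (chart R n M);
  manifold_hausdorff : hausdorff_space M;
  manifold_second_countable : @second_countable M;
  atlas_cover : forall x : M, exists c, atlas c /\ chart_dom c x;
  atlas_compatible : forall c d : chart R n M, atlas c -> atlas d ->
    smooth_on (c @` (chart_dom c `&` chart_dom d)) (d \o chart_inv c) }.

#[short(type="smoothManifoldType")]
HB.structure Definition SmoothManifold (R : realType) (n : nat) :=
  {M of PointedTopological M & isSmoothManifold R n M}.

Definition smooth_map {R : realType} {m n : nat} {M : smoothManifoldType R m}
    {N : smoothManifoldType R n} (f : M -> N) : Prop :=
  continuous f /\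
  forall (c : chart R m M) (d : chart R n N), atlas c -> atlas d ->
    smooth_on (chart_img c `&` [set u | chart_dom d (f (chart_inv c u))])
      (fun u => d (f (chart_inv c u))).

(* Smoothness of a map defined on the product manifold M x N, read in the
   product charts. *)
Definition smooth_map2 {R : realType} {m n k : nat}
    {M : smoothManifoldType R m} {N : smoothManifoldType R n}
    {P : smoothManifoldType R k} (f : M -> N -> P) : Prop :=
  continuous (fun z : M * N => f z.1 z.2) /\
  forall (c : chart R m M) (d : chart R n N) (e : chart R k P),
    atlas c -> atlas d -> atlas e ->
    smooth_on ((chart_img c `*` chart_img d) `&`
               [set u | chart_dom e (f (chart_inv c u.1) (chart_inv d u.2))])
      (fun u : 'rV[R]_m * 'rV[R]_n =>
         e (f (chart_inv c u.1) (chart_inv d u.2))).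

HB.mixin Record isLieGroup (R : realType) (n : nat) G
    of SmoothManifold R n G & Group G := {
  mul_smooth : smooth_map2 (fun x y : G => (x * y)%g);
  inv_smooth : smooth_map (fun x : G => (x^-1)%g) }.

#[short(type="lieGroupType")]
HB.structure Definition LieGroup (R : realType) (n : nat) :=
  {G of SmoothManifold R n G & Group G & isLieGroup R n G}.

(** * Tangent vectors *)

(* For every point x we choose once and for all a chart [chart_at x] of the
   atlas around x; the tangent space at x is 'rV[R]_n, a tangent vector being
   represented by its coordinates in the chart [chart_at x]. *)
Definition chart_at {R : realType} {n : nat} {M : smoothManifoldType R n}
  (x : M) : chart R n M := projT1 (cid (atlas_cover x)).

Definition differential {R : realType} {m n : nat}
    {M : smoothManifoldType R m} {N : smoothManifoldType R n} (f : M -> N)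
    (x : M) (v : 'rV[R]_m) : 'rV[R]_n :=
  'D_v (chart_at (f x) \o f \o chart_inv (chart_at x)) (chart_at x x).

(* The tangent vector at x whose coordinates in the chart c are v. *)
Definition of_coordinates {R : realType} {n : nat}
    {M : smoothManifoldType R n} (c : chart R n M) (x : M) (v : 'rV[R]_n) :
    'rV[R]_n :=
  'D_v (chart_at x \o chart_inv c) (c x).

Definition velocity {R : realType} {n : nat} {M : smoothManifoldType R n}
    (gamma : R -> M) (t : R) : 'rV[R]_n :=
  'D_1 (chart_at (gamma t) \o gamma) t.

(** * Riemannian metrics *)

(* [gram x] is the Gram matrix of the inner product on the tangent space at x.
   Since [chart_at] need not be locally constant, smoothness is required in the
   coordinates of each chart c. *)
Record riemannian_metric (R : realType) (n : nat)
    (M : smoothManifoldType R n) := RiemannianMetric {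
  gram : M -> 'M[R]_n;
  inner := fun (x : M) (v w : 'rV[R]_n) => (v *m gram x *m w^T) ord0 ord0;
  inner_sym : forall x v w, inner x v w = inner x w v;
  inner_pos : forall x v, v != 0 -> 0 < inner x v v;
  inner_smooth : forall (c : chart R n M) (v w : 'rV[R]_n), atlas c ->
    smooth_on (chart_img c) (fun u => let x := chart_inv c u in
      inner x (of_coordinates c x v) (of_coordinates c x w)) }.

Definition C1_curve_on {R : realType} {n : nat} {M : smoothManifoldType R n}
    (U : set R) (gamma : R -> M) : Prop :=
  (forall t, U t -> {for t, continuous gamma}) /\
  forall c : chart R n M, atlas c ->
    Ck 1 (U `&` [set t | chart_dom c (gamma t)]) (c \o gamma).

(* On each closed piece [a, b] the curve is the restriction of a C^1 curve
   defined on an open neighbourhood of [a, b]. *)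
Definition piecewise_C1 {R : realType} {n : nat} {M : smoothManifoldType R n}
    (gamma : R -> M) : Prop :=
  exists (N : nat) (t : nat -> R), t 0%N = 0 /\ t N = 1 /\
    forall i, (i < N)%N -> t i < t i.+1 /\
      exists (U : set R) (delta : R -> M),
        open U /\ `[t i, t i.+1] `<=` U /\ C1_curve_on U delta /\
        {in `[t i, t i.+1], gamma =1 delta}.

Definition curve_length {R : realType} {n : nat} {M : smoothManifoldType R n}
    (g : riemannian_metric M) (gamma : R -> M) : \bar R :=
  (\int[lebesgue_measure]_(t in `[0%R, 1%R])
    (Num.sqrt (inner g (gamma t) (velocity gamma t) (velocity gamma t)))%:E)%E.

(* The distance is +oo between points that are not joined by a curve. *)
Definition riemannian_distance {R : realType} {n : nat}
    {M : smoothManifoldType R n} (g : riemannian_metric M) (x y : M) : \bar R :=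
  ereal_inf [set curve_length g gamma | gamma in
    [set gamma | piecewise_C1 gamma /\ gamma 0 = x /\ gamma 1 = y]].

Definition left_invariant_metric {R : realType} {n : nat}
    {G : lieGroupType R n} (g : riemannian_metric G) : Prop :=
  forall (a x : G) (v w : 'rV[R]_n),
    inner g (a * x)%g (differential (fun y : G => (a * y)%g) x v)
                      (differential (fun y : G => (a * y)%g) x w)
    = inner g x v w.

(* [horizontal f g x v]: v is orthogonal to the kernel of df at x. *)
Definition horizontal {R : realType} {m n : nat} {M : smoothManifoldType R m}
    {N : smoothManifoldType R n} (f : M -> N) (g : riemannian_metric M)
    (x : M) (v : 'rV[R]_m) : Prop :=
  forall u : 'rV[R]_m, differential f x u = 0 -> inner g x u v = 0.

Definition riemannian_submersion {R : realType} {m n : nat}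
    {M : smoothManifoldType R m} {N : smoothManifoldType R n}
    (g : riemannian_metric M) (h : riemannian_metric N) (f : M -> N) : Prop :=
  smooth_map f /\
  (forall x (w : 'rV[R]_n), exists v, differential f x v = w) /\
  (forall x (v w : 'rV[R]_m), horizontal f g x v -> horizontal f g x w ->
    inner h (f x) (differential f x v) (differential f x w) = inner g x v w).

(** * Borel, Radon and Haar measures *)

Notation borelType T := (g_sigma_algebraType (@open T)).

Definition radon_measure {R : realType} {T : ptopologicalType}
    (mu : {measure set (borelType T) -> \bar R}) : Prop :=
  (forall K : set T, compact K -> (mu K < +oo)%E) /\
  (forall A : set T, measurable (A : set (borelType T)) ->
    mu A = ereal_inf [set mu U | U in [set U : set T | open U /\ A `<=` U]]) /\
  (forall U : set T, open U ->
    mu U = ereal_sup [set mu K | K in [set K : set T | compact K /\ K `<=` U]]).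

Definition left_invariant_measure {R : realType} {n : nat}
    {G : lieGroupType R n} (mu : {measure set (borelType G) -> \bar R}) : Prop :=
  forall (a : G) (A : set G), measurable (A : set (borelType G)) ->
    mu [set (a * x)%g | x in A] = mu A.

Definition right_invariant_measure {R : realType} {n : nat}
    {G : lieGroupType R n} (mu : {measure set (borelType G) -> \bar R}) : Prop :=
  forall (a : G) (A : set G), measurable (A : set (borelType G)) ->
    mu [set (x * a)%g | x in A] = mu A.

Definition left_haar {R : realType} {n : nat} {G : lieGroupType R n}
    (mu : {measure set (borelType G) -> \bar R}) : Prop :=
  radon_measure mu /\ mu [set: G] <> 0%E /\ left_invariant_measure mu.

Definition bi_invariant_haar {R : realType} {n : nat} {G : lieGroupType R n}
    (mu : {measure set (borelType G) -> \bar R}) : Prop :=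
  left_haar mu /\ right_invariant_measure mu.

Definition unimodular {R : realType} {n : nat} (G : lieGroupType R n) : Prop :=
  forall mu : {measure set (borelType G) -> \bar R},
    left_haar mu -> right_invariant_measure mu.

(** * Smooth right actions *)

Definition smooth_right_action {R : realType} {n k : nat}
    {G : lieGroupType R n} {M : smoothManifoldType R k} (act : M -> G -> M) :
    Prop :=
  (forall x, act x 1%g = x) /\
  (forall x a b, act x (a * b)%g = act (act x a) b) /\
  smooth_map2 act.

Definition transitive_action {G M : Type} (act : M -> G -> M) : Prop :=
  forall x y, exists a, act x a = y.

Definition invariant_measure {R : realType} {G : Type} {M : ptopologicalType}
    (act : M -> G -> M) (nu : {measure set (borelType M) -> \bar R}) : Prop :=
  forall (a : G) (A : set M), measurable (A : set (borelType M)) ->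
    nu [set act x a | x in A] = nu A.

(** * Volume doubling *)

Definition cball {R : realType} {T : Type} (d : T -> T -> \bar R) (x : T)
  (r : R) : set T := [set y | (d x y <= r%:E)%E].

Definition doubling_constant {R : realType} {T : ptopologicalType}
    (d : T -> T -> \bar R) (m : {measure set (borelType T) -> \bar R}) : \bar R :=
  ereal_sup [set q | exists (x : T) (r : R), 0 < r /\
    q = (m (cball d x (2 * r)) / m (cball d x r))%E].

(* A family of metric measure spaces on T is a set of pairs (distance,
   measure). *)
Definition uniformly_doubling {R : realType} {T : ptopologicalType}
    (F : set ((T -> T -> \bar R) * {measure set (borelType T) -> \bar R})) :
    Prop :=
  exists C : R, forall X, F X -> (doubling_constant X.1 X.2 <= C%:E)%E.

(* The doubling constants are unchanged when the measure is rescaled, so that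
   the choice of the Haar measure mu is irrelevant. *)
Definition uniformly_doubling_group {R : realType} {n : nat}
    (G : lieGroupType R n) : Prop :=
  exists mu : {measure set (borelType G) -> \bar R}, bi_invariant_haar mu /\
    uniformly_doubling
      [set (riemannian_distance g, mu) | g in @left_invariant_metric R n G].

(* Main.v *)
Require Import Defs.
From HB Require Import structures.
From mathcomp Require Import all_boot all_order all_algebra.
From mathcomp Require Import all_classical all_reals all_analysis.
From mathcomp Require Import measurable_realfun lra ring.
Import Order.TTheory GRing.Theory Num.Theory.
Import numFieldNormedType.Exports.
Local Open Scope classical_set_scope.
Local Open Scope ring_scope.
Set SsrOldRewriteGoalsOrder.
Set Implicit Arguments.
Unset Strict Implicit.
Unset Printing Implicit Defensive.

(** Write [B r] for the closed ball of radius [r] around 1 in [G], for a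
    left-invariant metric with distance [d].  Left invariance and symmetry of
    [d] give [(B r)^-1 = B r] and [B r * B s] inside [B (r + s)].  Since
    [sigma |-> act p sigma] is a Riemannian submersion whose fibres are the
    orbits of the left translations by the stabiliser of [p], which are
    isometries, the ball of radius [r] around [x] in [M] is, up to an arbitrarily
    small change of [r], the set [act x (B r)]: see [act_ball] and [ball_act].

    The measure [nu] need not be related to the metric, but it is invariant
    under the right action.  So one covers by right translates: take a maximal
    family of points [t_i] of [B (4 r)] such that the sets [B (r / 2) t_i] are
    disjoint.  They have equal Haar measure, by right invariance, and lie in
    [B (8 r)]; doubling in [G] bounds their number by [C ^ 4].  By maximality
    [B (4 r)] is covered by the sets [B r t_i], so the ball of radius [2 r]
    around [x] is covered by the sets [act (act x (B r)) t_i], each of measure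
    at most that of the ball of radius [r] around [x].  Hence [C ^ 4] bounds
    the doubling constants on [M] ([doubling_constant_quotient]).

    Everything else is about distances, and rests on one comparison principle,
    [dominated_le_distance]: a two-point function [E] that satisfies the
    triangle inequality and is bounded to first order at every point by the
    norm of the metric is bounded by the Riemannian distance.  The distance is
    itself dominated in this sense ([distance_dominated], by straight segments
    in charts), so that applying the principle to
    - the transposed distance gives symmetry;
    - the distance between images gives that maps whose derivatives do not
      increase norms do not increase distances, hence the invariance of [d]
      and the easy half of the description of balls in [M];
    - a cut-off coordinate distance gives that small balls are relatively
      compact, hence of finite measure;
    - the distance between fibres gives the other half of the description of
      balls in [M].  Its domination is an infinitesimal statement, proved by
      solving [act p s = y] for [s] near a given point by the contraction
      principle; no horizontal curve has to be lifted.

    The calculus of C^1 maps is done with strict differentiability, which on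
    open sets is equivalent to being C^1 ([C1_strict_diff],
    [strict_diff_C1]). *)

(** * Norms and neighbourhoods *)

(** The contraction principle lives on complete normed modules. *)
HB.instance Definition _ (R : realType) (n : nat) :=
  NormedModule.on 'rV[R]_n.

Lemma rV_coord_le_norm (R : realType) (n : nat) (v : 'rV[R]_n) (i : 'I_n) :
  `|v ord0 i| <= `|v|.
Proof.
rewrite [leRHS]/Num.Def.normr/= mx_normrE.
exact: (le_bigmax _ (fun ij => `|v ij.1 ij.2|) (ord0, i)).
Qed.

Lemma rV_norm_le (R : realType) (n : nat) (v : 'rV[R]_n) (e : R) :
  0 <= e -> (forall i, `|v ord0 i| <= e) -> `|v| <= e.
Proof.
move=> e0 ve; rewrite [leLHS]/Num.Def.normr/= mx_normrE bigmax_le// => -[i j] _ /=.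
by rewrite (ord1 i); exact: ve.
Qed.

Lemma rV_norm_lt (R : realType) (n : nat) (v : 'rV[R]_n) (e : R) :
  0 < e -> (forall i, `|v ord0 i| < e) -> `|v| < e.
Proof.
move=> e0 ve; rewrite [ltLHS]/Num.Def.normr/= mx_normrE bigmax_lt// => -[i j] _ /=.
by rewrite (ord1 i); exact: ve.
Qed.

Lemma near_norm_lt (R : realType) (V : normedModType R) (x : V) (P : set V) :
  (\forall y \near x, P y) -> exists2 d : R, 0 < d & forall y, `|y - x| < d -> P y.
Proof.
move=> /nbhs_ballP[r /= r0 xP]; exists r => // y yr.
by apply: xP; rewrite -ball_normE /ball_ /= distrC.
Qed.

Lemma norm_lt_near (R : realType) (V : normedModType R) (x : V) (P : set V)
    (d : R) :
  0 < d -> (forall y, `|y - x| < d -> P y) -> \forall y \near x, P y.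
Proof.
move=> d0 xP; apply/nbhs_ballP; exists d => // y.
by rewrite -ball_normE /ball_ /= distrC; exact: xP.
Qed.

Lemma continuous_norm_ltP (R : realType) (V W : normedModType R) (f : V -> W)
    (x : V) :
  {for x, continuous f} <-> forall e : R, 0 < e -> exists2 d : R, 0 < d &
    forall y, `|y - x| < d -> `|f y - f x| < e.
Proof.
split=> [cf e e0|cf].
  have {}cf : f y @[y --> x] --> f x := cf.
  apply: near_norm_lt; near=> y; rewrite distrC.
  by near: y; exact: cvgr_dist_lt.
apply/cvgrPdist_lt => e /cf[d d0 fd]; apply: (norm_lt_near d0) => y /fd.
by rewrite distrC.
Unshelve. all: by end_near. Qed.

(** * Strict differentiability *)

(** Strict differentiability at every point of an open set is the same as
    being C^1 there; unlike plain differentiability it feeds the contraction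
    principle directly, and unlike iterated directional derivatives it
    satisfies the chain rule by a one-line estimate. *)
Definition strict_diff {R : realType} {V W : normedModType R} (f : V -> W)
    (x : V) (L : {linear V -> W}) : Prop :=
  (exists2 K : R, 0 < K & forall v, `|L v| <= K * `|v|) /\
  forall e : R, 0 < e -> exists2 d : R, 0 < d & forall y z,
    `|y - x| < d -> `|z - x| < d ->
    `|f y - f z - L (y - z)| <= e * `|y - z|.

Lemma strict_diff_is_derive (R : realType) (V W : normedModType R)
    (f : V -> W) (x : V) (L : {linear V -> W}) (v : V) :
  strict_diff f x L -> is_derive x v f (L v).
Proof.
move=> [_ fL].
suff H : (h^-1 *: ((f \o shift x) (h *: v) - f x)) @[h --> 0^'] --> L v.
  split; first by apply/cvg_ex; exists (L v).
  exact: cvg_lim.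
apply/cvgrPdist_le => e e0.
have v1 : 0 < `|v| + 1 by rewrite ltr_wpDl.
have [d d0 fd] := fL (e / (`|v| + 1)) (divr_gt0 e0 v1).
near=> h.
have h0 : h != 0 by near: h; exact: nbhs_dnbhs_neq.
have hd : `|h| < d / (`|v| + 1) by near: h; apply: dnbhs0_lt; rewrite divr_gt0.
have hv : `|h *: v| < d.
  rewrite normrZ; rewrite ltr_pdivlMr// in hd.
  by apply: le_lt_trans hd; rewrite ler_wpM2l// lerDl.
have := fd (h *: v + x) x; rewrite addrK subrr normr0 => /(_ hv d0) => H.
have -> : L v - h^-1 *: ((f \o shift x) (h *: v) - f x) =
    - (h^-1 *: (f (h *: v + x) - f x - L (h *: v))).
  by rewrite [L (h *: v)]linearZZ !scalerBr scalerA mulVf// scale1r !opprB /shift/=.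
rewrite normrN normrZ normfV ler_pdivrMl ?normr_gt0//.
apply: (le_trans H); rewrite normrZ mulrCA ler_wpM2l// mulrAC ler_pdivrMr//.
by rewrite ler_wpM2l ?(ltW e0)// lerDl.
Unshelve. all: by end_near. Qed.

Lemma strict_diff_continuous (R : realType) (V W : normedModType R)
    (f : V -> W) (x : V) (L : {linear V -> W}) :
  strict_diff f x L -> {for x, continuous f}.
Proof.
move=> [[K K0 LK] fL]; apply/cvgrPdist_le => e e0.
have [d d0 fd] := fL 1 ltr01.
have K1 : 0 < K + 1 by rewrite ltr_wpDl ?ltW.
near=> y.
have yd : `|x - y| < d by near: y; exact: cvgr_dist_lt.
have ye : `|x - y| < e / (K + 1).
  by near: y; apply: cvgr_dist_lt => //; rewrite divr_gt0.
have H : `|f x - f y - L (x - y)| <= 1 * `|x - y|.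
  by apply: fd; rewrite ?subrr ?normr0// distrC.
rewrite -[f x - f y](subrK (L (x - y))).
apply: (le_trans (ler_normD _ _)).
apply: (@le_trans _ _ (`|x - y| * (K + 1))).
  by rewrite mulrDr mulr1 addrC lerD// ?mul1r// ?(mulrC _ K) // -[leRHS]mul1r.
by rewrite -ler_pdivlMr// ltW.
Unshelve. all: by end_near. Qed.

Lemma strict_diff_comp (R : realType) (V W Z : normedModType R)
    (f : V -> W) (g : W -> Z) (x : V) (L : {linear V -> W})
    (L' : {linear W -> Z}) :
  strict_diff f x L -> strict_diff g (f x) L' ->
  strict_diff (g \o f) x (L' \o L).
Proof.
move=> fx gx; have cf := strict_diff_continuous fx.
move: fx gx => [[K K0 LK] fL] [[K' K'0 LK'] gL]; split.
  exists (K' * K); first by rewrite mulr_gt0.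
  by move=> v /=; rewrite (le_trans (LK' _))// -mulrA ler_wpM2l// ltW.
move=> e e0.
have [e1 e10 [e2 e20 ee]] : exists2 e1 : R, 0 < e1 & exists2 e2 : R, 0 < e2 &
    e2 * (K + e1) + K' * e1 <= e.
  have K1 : 0 < K + 1 by rewrite addr_gt0.
  exists (Num.min 1 (e / 2 / K')); first by rewrite lt_min ltr01 !divr_gt0.
  exists (e / 2 / (K + 1)); first by rewrite !divr_gt0.
  rewrite [leRHS]splitr lerD//.
    rewrite -[leRHS](divfK (lt0r_neq0 K1)) ler_wpM2l//.
      by rewrite !divr_ge0// ltW.
    by rewrite lerD2l ge_min lexx.
  rewrite mulrC -[leRHS](divfK (lt0r_neq0 K'0)) ler_wpM2r ?(ltW K'0)//.
  by rewrite ge_min lexx orbT.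
have [d1 d10 fd] := fL e1 e10.
have [d2 d20 gd] := gL e2 e20.
have /near_norm_lt[d3 d30 fd3] : \forall y \near x, `|f y - f x| < d2.
  have {}cf : f y @[y --> x] --> f x := cf.
  by near=> y; rewrite distrC; near: y; exact: cvgr_dist_lt.
exists (Num.min d1 d3); first by rewrite lt_min d10.
move=> y z; rewrite !lt_min => /andP[y1 y3] /andP[z1 z3].
have Hf := fd y z y1 z1.
have Hg := gd (f y) (f z) (fd3 y y3) (fd3 z z3).
have fyz : `|f y - f z| <= (K + e1) * `|y - z|.
  rewrite -[f y - f z](subrK (L (y - z))) (le_trans (ler_normD _ _))//.
  by rewrite mulrDl addrC lerD.
rewrite /=.
have -> : g (f y) - g (f z) - L' (L (y - z)) =
    (g (f y) - g (f z) - L' (f y - f z)) + L' (f y - f z - L (y - z)).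
  by rewrite [L' (_ - L _)]linearB addrA subrK.
apply: (le_trans (ler_normD _ _)).
apply: (@le_trans _ _ ((e2 * (K + e1) + K' * e1) * `|y - z|)); last first.
  by rewrite ler_wpM2r.
rewrite mulrDl lerD//.
  by rewrite (le_trans Hg)// -mulrA ler_wpM2l// ltW.
by rewrite (le_trans (LK' _))// -mulrA ler_wpM2l// ltW.
Unshelve. all: by end_near. Qed.

Lemma strict_diff_near_eq (R : realType) (V W : normedModType R)
    (f g : V -> W) (x : V) (L : {linear V -> W}) :
  (\forall y \near x, f y = g y) -> strict_diff f x L -> strict_diff g x L.
Proof.
move=> /near_norm_lt[r r0 fg] [LK fL]; split=> // e e0; have [d d0 fd] := fL e e0.
exists (Num.min d r); first by rewrite lt_min d0.
move=> y z; rewrite !lt_min => /andP[yd yr] /andP[zd zr].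
by rewrite -!fg//; exact: fd.
Qed.

Lemma strict_diff_lin (R : realType) (V W : normedModType R)
    (L : {linear V -> W}) (x : V) (K : R) :
  0 < K -> (forall v, `|L v| <= K * `|v|) -> strict_diff L x L.
Proof.
move=> K0 LK; split; first by exists K.
move=> e e0; exists 1 => // y z _ _.
by rewrite -linearB subrr normr0 mulr_ge0// ltW.
Qed.

Lemma strict_diff_shift (R : realType) (V W : normedModType R)
    (f : V -> W) (x : V) (L : {linear V -> W}) (c : W) :
  strict_diff f x L -> strict_diff (fun y => c + f y) x L.
Proof.
move=> [LK fL]; split=> // e /fL[d d0 fd]; exists d => // y z yd zd.
by rewrite opprD addrACA subrr add0r; exact: fd.
Qed.

(** The derivatives at [x] and at a nearby point are both close to the same
    difference quotient, over a short segment starting at that point. *)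
Lemma strict_diff_derive_continuous (R : realType) (V W : normedModType R)
    (f : V -> W) (x v : V) :
  (\forall y \near x, exists L : {linear V -> W}, strict_diff f y L) ->
  {for x, continuous (fun y => 'D_v f y)}.
Proof.
move=> fN; have [L fL] := nbhs_singleton fN.
apply/cvgrPdist_le => e e0.
have v1 : 0 < `|v| + 1 by rewrite ltr_wpDl.
have [d d0 fd] := fL.2 (e / 2 / (`|v| + 1)) (divr_gt0 (divr_gt0 e0 (ltr0n _ 2)) v1).
near=> y.
have [L' fL'] : exists L : {linear V -> W}, strict_diff f y L.
  by near: y.
rewrite (@derive_val _ _ _ _ _ _ _ (strict_diff_is_derive v fL)).
rewrite (@derive_val _ _ _ _ _ _ _ (strict_diff_is_derive v fL')).
have yd : `|y - x| < d / 2.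
  by rewrite distrC; near: y; apply: cvgr_dist_lt => //; rewrite divr_gt0.
have [d' d'0 fd'] := fL'.2 (e / 2 / (`|v| + 1)) (divr_gt0 (divr_gt0 e0 (ltr0n _ 2)) v1).
pose m := Num.min (d / 2) d'.
have m0 : 0 < m by rewrite lt_min d'0 divr_gt0.
have [h h0 hv] : exists2 h : R, 0 < h & `|h *: v| < m.
  have h0 : 0 < m / (`|v| + 1) by rewrite divr_gt0.
  exists (m / (`|v| + 1)) => //.
  by rewrite normrZ gtr0_norm// mulrAC ltr_pdivrMr// ltr_pM2l// ltrDl.
have hv1 : `|h *: v| < d / 2 by rewrite (lt_le_trans hv)// /m ge_min lexx.
have hv2 : `|h *: v| < d' by rewrite (lt_le_trans hv)// /m ge_min lexx orbT.
have A : `|f (h *: v + y) - f y - L (h *: v)| <= e / 2 / (`|v| + 1) * `|h *: v|.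
  have := fd (h *: v + y) y; rewrite addrK; apply; last first.
    by rewrite (lt_trans yd)// ltr_pdivrMr// ltr_pMr// ltr1n.
  by rewrite -addrA (le_lt_trans (ler_normD _ _))// [d]splitr ltrD.
have B : `|f (h *: v + y) - f y - L' (h *: v)| <= e / 2 / (`|v| + 1) * `|h *: v|.
  by have := fd' (h *: v + y) y; rewrite addrK subrr normr0; apply.
have C : `|L (h *: v) - L' (h *: v)| <= e / (`|v| + 1) * `|h *: v|.
  apply: le_trans (_ : e / 2 / (`|v| + 1) * `|h *: v| + e / 2 / (`|v| + 1) * `|h *: v| <= _); last first.
    by rewrite -mulrDl -mulrDl -splitr.
  apply: le_trans (lerD A B).
  rewrite distrC (le_trans _ (ler_normB _ _))// opprB.
  by rewrite [X in _ <= `|X|]addrC subrKA.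
have E : L (h *: v) - L' (h *: v) = h *: (L v - L' v).
  by rewrite scalerBr !linearZZ.
move: C; rewrite E !normrZ mulrCA ler_pM2l ?normr_gt0 ?gt_eqF//.
move=> C; apply: (le_trans C); rewrite mulrAC ler_pdivrMr// ler_wpM2l ?(ltW e0)//.
by rewrite lerDl.
Unshelve. all: by end_near. Qed.

(** * Strict differentiability of C^1 maps *)

Lemma is_derive_line (R : realType) (V W : normedModType R) (f : V -> W)
    (x v : V) (t : R) :
  derivable f (x + t *: v) v ->
  is_derive t 1 (fun s : R => f (x + s *: v)) ('D_v f (x + t *: v)).
Proof.
rewrite /derivable /derive => fv.
have E : (fun h : R => h^-1 *: (((fun s : R => f (x + s *: v)) \o shift t)
    (h *: (1 : R)) - f (x + t *: v))) =
    (fun h => h^-1 *: ((f \o shift (x + t *: v)) (h *: v) - f (x + t *: v))).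
  apply/funext => h /=; do 2 f_equal; congr f.
  by rewrite [h%:A]mulr1 scalerDl addrCA.
by split; rewrite /derivable /derive E.
Qed.

Lemma line_estimate0 (R : realType) (V : normedModType R) (g : V -> R)
    (x v : V) (s c eta : R) : 0 <= s ->
  (forall t, 0 <= t <= s -> derivable g (x + t *: v) v /\
     `|'D_v g (x + t *: v) - c| <= eta) ->
  `|g (x + s *: v) - g x - s * c| <= s * eta.
Proof.
move=> s0 H.
have dg t : 0 <= t <= s ->
    is_derive t (1 : R) (fun s : R => g (x + s *: v)) ('D_v g (x + t *: v)).
  by move=> /H[? _]; exact: is_derive_line.
have [||t] := @MVT_segment R (fun s : R => g (x + s *: v))
    (fun t => 'D_v g (x + t *: v)) 0 s s0.
- by move=> t /[!in_itv]/= /andP[/ltW ? /ltW ?]; apply: dg; apply/andP.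
- apply: derivable_within_continuous => t /[!in_itv]/= ts.
  exact: (@ex_derive _ _ _ _ _ _ _ (dg _ ts)).
rewrite in_itv/= scale0r addr0 subr0 => ts ->.
by rewrite mulrC -mulrBr normrM ger0_norm// ler_wpM2l//; case: (H t ts).
Qed.

(** Mean value inequality along a line, for a step [s] of either sign. *)
Lemma line_estimate (R : realType) (V : normedModType R) (g : V -> R)
    (x v : V) (s c eta : R) :
  (forall t, `|t| <= `|s| -> derivable g (x + t *: v) v /\
     `|'D_v g (x + t *: v) - c| <= eta) ->
  `|g (x + s *: v) - g x - s * c| <= `|s| * eta.
Proof.
move=> H; have [s0|s0] := leP 0 s.
  rewrite (ger0_norm s0); apply: line_estimate0 => // t /andP[t0 ts].
  by apply: H; rewrite !ger0_norm.
have ns : 0 <= - s by rewrite oppr_ge0 ltW.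
have := @line_estimate0 _ _ g (x + s *: v) v (- s) c eta ns.
have -> : x + s *: v + - s *: v = x by rewrite scaleNr addrK.
rewrite (ltr0_norm s0) mulNr opprK.
move=> K; rewrite -normrN !opprD !opprK [X in X + _]addrC; apply: K => t /andP[t0 ts].
rewrite -addrA -scalerDl; apply: H; rewrite (ltr0_norm s0) ler_norml opprK.
by apply/andP; split; lra.
Qed.

(** The coordinate telescoping behind the classical fact that continuous
    partial derivatives imply differentiability: go from [z] to [y] changing
    one coordinate at a time. *)
Lemma C1_strict_diff_scalar (R : realType) (m : nat) (U : set 'rV[R]_m)
    (g : 'rV[R]_m -> R) (x : 'rV[R]_m) :
  open U -> U x ->
  (forall v, (forall y, U y -> derivable g y v) /\
     forall e : R, 0 < e -> exists2 d : R, 0 < d &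
       forall y, `|y - x| < d -> `|'D_v g y - 'D_v g x| < e) ->
  forall e : R, 0 < e -> exists2 d : R, 0 < d & forall y z,
    `|y - x| < d -> `|z - x| < d ->
    `|g y - g z - \sum_(i < m) (y - z) ord0 i * 'D_(delta_mx ord0 i) g x|
      <= e * `|y - z|.
Proof.
move=> oU Ux dg e e0.
have m1 : (0 : R) < m%:R + 1 by rewrite ltr_wpDl.
pose eta := e / (m%:R + 1).
have eta0 : 0 < eta by rewrite divr_gt0.
have [d d0 Hd] : exists2 d : R, 0 < d & forall y, `|y - x| < d -> U y /\
    forall i : 'I_m, `|'D_(delta_mx ord0 i) g y - 'D_(delta_mx ord0 i) g x| <= eta.
  have [d2 d20 d2U] := near_norm_lt (open_nbhs_nbhs (conj oU Ux)).
  have /fin_all_exists2[d1 d10 d1P] : forall i : 'I_m, exists2 d : R, 0 < d &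
      forall y, `|y - x| < d ->
        `|'D_(delta_mx ord0 i) g y - 'D_(delta_mx ord0 i) g x| < eta.
    by move=> i; have [_ /(_ _ eta0)] := dg (delta_mx ord0 i).
  exists (\big[Num.min/d2]_i d1 i).
    by apply/bigmin_gtP; split=> // i _; exact: d10.
  by move=> y /bigmin_gtP[yd2 yd1]; split=> [|i]; [exact: d2U|exact/ltW/d1P/yd1].
exists (d / 3); first by rewrite divr_gt0.
move=> y z yd zd.
pose p (k : nat) : 'rV[R]_m := \row_i (if (i < k)%N then y ord0 i else z ord0 i).
have p0 : p 0%N = z by apply/rowP => i; rewrite mxE.
have pm : p m = y by apply/rowP => i; rewrite mxE ltn_ord.
have pS (k : 'I_m) : p k.+1 = p k + (y - z) ord0 k *: delta_mx ord0 k.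
  apply/rowP => i; rewrite !mxE ltnS leq_eqVlt eqxx/=.
  have [ki|ki] := eqVneq i k.
    by rewrite ki eqxx ltnn/= mulr1 addrC subrK.
  by rewrite (negbTE (_ : nat_of_ord i != k)) //= mulr0 addr0.
have step (k : 'I_m) : `|g (p k.+1) - g (p k) -
    (y - z) ord0 k * 'D_(delta_mx ord0 k) g x| <= `|y - z| * eta.
  rewrite pS; apply: (@le_trans _ _ (`|(y - z) ord0 k| * eta)); last first.
    by rewrite ler_wpM2r ?(ltW eta0)// rV_coord_le_norm.
  apply: line_estimate => t ht.
  have tyz : `|t| < d / 3 + d / 3.
    apply: (le_lt_trans ht); apply: (le_lt_trans (rV_coord_le_norm _ _)).
    by rewrite -(subrKA x) (le_lt_trans (ler_normD _ _))// ltrD// distrC.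
  have [] := Hd (p k + t *: delta_mx ord0 k).
    apply: rV_norm_lt => // i; rewrite !mxE eqxx/= addrAC.
    have A : `|(if (i < k)%N then y ord0 i else z ord0 i) - x ord0 i| < d / 3.
      case: ifP => _.
        by have := rV_coord_le_norm (y - x) i; rewrite !mxE => /le_lt_trans; apply.
      by have := rV_coord_le_norm (z - x) i; rewrite !mxE => /le_lt_trans; apply.
    rewrite (le_lt_trans (ler_normD _ _))// normrM.
    have -> : d = d / 3 + (d / 3 + d / 3) by lra.
    rewrite ltr_leD// (le_trans _ (ltW tyz))// ler_piMr//.
    by case: eqP => _; rewrite ?normr1 ?normr0.
  move=> Up Dp; split; last exact: Dp.
  by have [D _] := dg (delta_mx ord0 k); exact: D.
have -> : g y - g z = \sum_(k < m) (g (p k.+1) - g (p k)).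
  by rewrite -p0 -pm -(telescope_sumr (fun k => g (p k)))// big_mkord.
rewrite -sumrB (le_trans (ler_norm_sum _ _ _))//.
apply: (@le_trans _ _ (\sum_(k < m) `|y - z| * eta)).
  by apply: ler_sum => k _; exact: step.
rewrite sumr_const card_ord -mulr_natl mulrCA (mulrC e) ler_wpM2l//.
by rewrite /eta mulrA ler_pdivrMr// mulrC ler_wpM2l ?(ltW e0)// lerDl.
Unshelve. all: by end_near. Qed.

Lemma mulmx_norm_le (R : realType) (m n : nat) (A : 'M[R]_(m, n)) :
  exists2 K : R, 0 < K & forall v : 'rV[R]_m, `|v *m A| <= K * `|v|.
Proof.
exists (m%:R * `|A| + 1); first by rewrite ltr_wpDl// mulr_ge0.
move=> v; apply: rV_norm_le.
  by rewrite mulr_ge0// addr_ge0// mulr_ge0.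
move=> j /=; rewrite mxE (le_trans (ler_norm_sum _ _ _))//.
apply: (@le_trans _ _ (\sum_(i < m) `|v| * `|A|)).
  apply: ler_sum => i _; rewrite normrM ler_pM// ?rV_coord_le_norm//.
  rewrite [leRHS]/Num.Def.normr/= mx_normrE.
  exact: (le_bigmax _ (fun ij => `|A ij.1 ij.2|) (i, j)).
rewrite sumr_const card_ord -mulr_natl.
by have : 0 <= `|v| by []; move: `|v| `|A| => a b; lra.
Qed.

Lemma C1_strict_diff (R : realType) (m n : nat) (U : set 'rV[R]_m)
    (f : 'rV[R]_m -> 'rV[R]_n) (x : 'rV[R]_m) :
  open U -> Ck 1 U f -> U x -> exists L : {linear 'rV[R]_m -> 'rV[R]_n},
    strict_diff f x L.
Proof.
move=> oU /= [_ fU] Ux.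
pose A : 'M[R]_(m, n) := \matrix_(i, j) ('D_(delta_mx ord0 i) f x) ord0 j.
exists (mulmxr A).
have dcoord v j y : U y -> derivable (fun y => f y ord0 j) y v /\
    'D_v (fun y => f y ord0 j) y = ('D_v f y) ord0 j.
  move=> Uy; have [fv _] := fU v; split.
    by have /derivable_mxP := fv _ Uy; exact.
  by rewrite (derive_mx (fv _ Uy)) mxE.
have key (j : 'I_n) (e : R) : 0 < e -> exists2 d : R, 0 < d & forall y z,
    `|y - x| < d -> `|z - x| < d ->
    `|(f y - f z - (y - z) *m A) ord0 j| <= e * `|y - z|.
  move=> e0.
  have [|d d0 H] := @C1_strict_diff_scalar R m U (fun y => f y ord0 j) x oU Ux _ e e0.
    move=> v; split; first by move=> y /(dcoord v j)[].
    have [_ [cv _]] := fU v.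
    move=> r r0.
    have /continuous_norm_ltP/(_ _ r0)[d1 d10 d1P] := cv _ Ux.
    have [d2 d20 d2U] := near_norm_lt (open_nbhs_nbhs (conj oU Ux)).
    exists (Num.min d1 d2) => [|y]; first by rewrite lt_min d10.
    rewrite lt_min => /andP[/d1P y1 /d2U Uy].
    rewrite (dcoord v j y Uy).2 (dcoord v j x Ux).2.
    apply: le_lt_trans y1.
    by have := rV_coord_le_norm ('D_v f y - 'D_v f x) j; rewrite !mxE.
  exists d => // y z yd zd; have := H y z yd zd.
  rewrite !mxE; under eq_bigr => i _ do rewrite (dcoord _ _ _ Ux).2.
  move=> {}H; have -> // : \sum_i (y - z) ord0 i * A i j =
    \sum_i (y - z) ord0 i * ('D_(delta_mx ord0 i) f x) ord0 j.
  by apply: eq_bigr => i _; rewrite [A _ _]mxE.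
split; last first.
  move=> e e0.
  have /fin_all_exists2[d d0 H] : forall j : 'I_n, exists2 d : R, 0 < d & forall y z,
    `|y - x| < d -> `|z - x| < d ->
    `|(f y - f z - (y - z) *m A) ord0 j| <= e * `|y - z|.
    by move=> j; exact: key.
  exists (\big[Num.min/1]_j d j).
    by apply/bigmin_gtP; split=> // j _; exact: d0.
  move=> y z /bigmin_gtP[_ yd] /bigmin_gtP[_ zd].
  apply: rV_norm_le; first by rewrite mulr_ge0// ltW.
  by move=> j; apply: H; [exact: yd|exact: zd].
exact: mulmx_norm_le.
Unshelve. all: by end_near. Qed.

Lemma C1_strict_diff_line (R : realType) (n : nat) (U : set R)
    (f : R -> 'rV[R]_n) (t : R) :
  open U -> Ck 1 U f -> U t -> exists L : {linear R -> 'rV[R]_n},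
    strict_diff f t L.
Proof.
move=> oU /= [_ fU] Ut; have [f1 [/(_ _ Ut)/continuous_norm_ltP c1 _]] := fU 1.
pose w := 'D_1 f t.
have lw : linear (fun s : R => s *: w) by move=> a x y; rewrite scalerDl scalerA.
pose L : {linear R -> 'rV[R]_n} := HB.pack (fun s : R => s *: w)
  (GRing.isLinear.Build R R 'rV[R]_n _ _ lw).
exists L; split.
  exists (`|w| + 1); first by rewrite ltr_wpDl.
  by move=> s /=; rewrite normrZ mulrC ler_wpM2r// lerDl.
move=> e e0; have [d1 d10 d1P] := c1 e e0.
have [d2 d20 d2U] := near_norm_lt (open_nbhs_nbhs (conj oU Ut)).
exists (Num.min d1 d2 / 3); first by rewrite divr_gt0// lt_min d10.
move=> y z yd zd.
apply: rV_norm_le; first by rewrite mulr_ge0// ltW.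
move=> j; rewrite !mxE.
have := @line_estimate R R (fun s => f s ord0 j) z 1 (y - z) (w ord0 j) e.
rewrite [(y - z)%:A]mulr1 subrKC (mulrC e); apply=> s syz.
have sd : `|z + s%:A - t| < Num.min d1 d2.
  rewrite [s%:A]mulr1 addrAC (le_lt_trans (ler_normD _ _))//.
  have : `|s| < Num.min d1 d2 / 3 + Num.min d1 d2 / 3.
    apply: (le_lt_trans syz).
    by rewrite -(subrKA t) (le_lt_trans (ler_normD _ _))// ltrD// distrC.
  by move=> ?; lra.
move: sd; rewrite lt_min => /andP[/d1P sd1 /d2U Us].
split; first by have /derivable_mxP := f1 _ Us; exact.
have -> : 'D_1 (fun s : R => f s ord0 j) (z + s%:A) = ('D_1 f (z + s%:A)) ord0 j.
  by rewrite (derive_mx (f1 _ Us)) mxE.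
apply: ltW; apply: le_lt_trans sd1.
by have := rV_coord_le_norm ('D_1 f (z + s%:A) - w) j; rewrite !mxE.
Qed.

Lemma strict_diff_C1 (R : realType) (V W : normedModType R) (U : set V)
    (f : V -> W) :
  open U -> (forall x, U x -> exists L : {linear V -> W}, strict_diff f x L) ->
  Ck 1 U f.
Proof.
move=> oU fU; split.
  by move=> x /fU[L] /strict_diff_continuous.
move=> v; split.
  move=> x /fU[L] /(strict_diff_is_derive v) fL.
  exact: (@ex_derive _ _ _ _ _ _ _ fL).
split=> // x Ux; apply: strict_diff_derive_continuous.
have [d d0 dU] := near_norm_lt (open_nbhs_nbhs (conj oU Ux)).
by apply: (norm_lt_near d0) => y /dU/fU.
Qed.

(** The derivative of a slice along [v] is that of [F] along [(0, v)]. *)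
Lemma Ck1_slice (R : realType) (V W Z : normedModType R) (U : set (V * W))
    (F : V * W -> Z) (u : V) :
  Ck 1 U F -> Ck 1 [set w | U (u, w)] (fun w => F (u, w)).
Proof.
move=> [cF DF].
have cu : continuous (fun w : W => (u, w)).
  by move=> w; apply: cvg_pair; [exact: cvg_cst|exact: cvg_id].
split.
  move=> w Uw; apply: (@continuous_comp _ _ _ (fun w => (u, w)) F); first exact: cu.
  exact: cF.
move=> v; have [dF [cDF _]] := DF (0, v).
have E w : (fun h : R => h^-1 *: (((fun w => F (u, w)) \o shift w) (h *: v) - F (u, w))) =
    (fun h => h^-1 *: ((F \o shift (u, w)) (h *: (0, v)) - F (u, w))).
  apply/funext => h /=; congr (_ *: (F _ - _)).
  transitivity (h *: (0 : V) + u, h *: v + w); last by [].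
  by rewrite scaler0 add0r.
have DE w : 'D_v (fun w => F (u, w)) w = 'D_(0, v) F (u, w).
  by rewrite /derive E.
split; first by move=> w Uw; rewrite /derivable E; exact: dF.
split=> // w Uw; rewrite (_ : (fun _ => _) = ('D_(0, v) F) \o (fun w => (u, w))).
  by apply: continuous_comp; [exact: cu|exact: cDF].
by apply/funext => w' /=.
Qed.

(** Quantitative local surjectivity: solve [F w = y] as the fixed point of
    [w |-> w - (F w - y)], a contraction near [0] because [F] is strictly
    differentiable there with derivative the identity. *)
Lemma strict_diff_local_surj (R : realType) (k : nat)
    (F : 'rV[R]_k -> 'rV[R]_k) (e : R) :
  strict_diff F 0 idfun -> 0 < e -> exists2 d : R, 0 < d &
    forall y, `|y - F 0| < d -> exists2 w, F w = y &
      `|w - (y - F 0)| <= e * `|y - F 0|.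
Proof.
move=> [_ FL] e0.
pose q := Num.min (1 / 2) (e / 2).
have q0 : 0 < q by rewrite lt_min !divr_gt0.
have q12 : q <= 1 / 2 by rewrite ge_min lexx.
have qe : q <= e / 2 by rewrite ge_min lexx orbT.
have [r r0 Fr] := FL q q0.
exists (r / 4); first by rewrite divr_gt0.
move=> y yd.
pose U := [set w : 'rV[R]_k | `|w| <= 2 * `|y - F 0|].
have Ur w : U w -> `|w - 0| < r.
  by rewrite /U/= subr0 => /le_lt_trans; apply; lra.
have r00 : `|(0 : 'rV[R]_k) - 0| < r by rewrite subrr normr0.
pose T (w : 'rV[R]_k) := w - (F w - y).
have TE (w w' : 'rV[R]_k) : T w - T w' = - (F w - F w' - (w - w')).
  rewrite /T; apply/rowP => i; rewrite !mxE; ring.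
have T0 : T 0 = y - F 0 by rewrite /T add0r opprB.
have Tq w : U w -> `|T w - (y - F 0)| <= q * `|w|.
  move=> Uw; rewrite -T0 TE normrN.
  by have := Fr w 0 (Ur w Uw) r00; rewrite subr0.
have TU : set_fun U U T.
  move=> w Uw; rewrite /U/= -[T w](subrK (y - F 0)) (le_trans (ler_normD _ _))//.
  have := Tq w Uw; move: Uw; rewrite /U/= => Uw.
  have A : q * `|w| <= 1 / 2 * (2 * `|y - F 0|).
    by rewrite ler_pM// ltW.
  by move=> B; lra.
have q0' : 0 <= q by rewrite ltW.
pose T' : {fun U >-> U} := HB.pack T (isFun.Build _ _ U U T TU).
have ctr : is_contraction T'.
  exists (NngNum q0'); split=> /=; first by lra.
  move=> [w w'] [/= Uw Uw']; rewrite TE normrN.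
  exact: Fr (Ur _ Uw) (Ur _ Uw').
have [||w Uw wE] := banach_fixed_point ctr.
- apply: (@closed_comp _ _ (fun w : 'rV[R]_k => `|w|) [set s | s <= 2 * `|y - F 0|]).
    by move=> ? _; exact: norm_continuous.
  exact: closed_le.
- by exists 0; rewrite /U/= normr0 mulr_ge0.
have {}wE : w = T w by exact: wE.
exists w.
  apply/eqP; rewrite -subr_eq0; apply/eqP; transitivity (w - T w).
    by rewrite /T opprB addrCA subrr addr0.
  by rewrite -wE subrr.
rewrite {1}wE; apply: (le_trans (Tq w Uw)).
move: Uw; rewrite /U/= => Uw.
apply: (@le_trans _ _ (e / 2 * (2 * `|y - F 0|))).
  by rewrite ler_pM// ltW.
by rewrite mulrA divfK.
Qed.

(** * Manifolds in charts *)

Lemma chart_at_atlas (R : realType) (n : nat) (M : smoothManifoldType R n)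
  (x : M) : atlas (chart_at x).
Proof. by rewrite /chart_at; case: cid => c []. Qed.

Lemma chart_at_dom (R : realType) (n : nat) (M : smoothManifoldType R n)
  (x : M) : chart_dom (chart_at x) x.
Proof. by rewrite /chart_at; case: cid => c []. Qed.

Lemma chart_img_map (R : realType) (n : nat) (M : topologicalType)
  (c : chart R n M) (x : M) : chart_dom c x -> chart_img c (c x).
Proof. by move=> cx; exists x. Qed.

Lemma chart_invK (R : realType) (n : nat) (M : topologicalType)
  (c : chart R n M) (u : 'rV[R]_n) : chart_img c u -> c (chart_inv c u) = u.
Proof. by move=> [x cx <-]; rewrite chart_mapK. Qed.

Lemma chart_inv_dom (R : realType) (n : nat) (M : topologicalType)
  (c : chart R n M) (u : 'rV[R]_n) : chart_img c u -> chart_dom c (chart_inv c u).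
Proof. by move=> [x cx <-]; rewrite chart_mapK. Qed.

Lemma chart_img_near (R : realType) (n : nat) (M : topologicalType)
    (c : chart R n M) (x : M) : chart_dom c x ->
  exists2 d : R, 0 < d & forall u, `|u - c x| < d -> chart_img c u.
Proof.
move=> cx; apply: near_norm_lt; apply: open_nbhs_nbhs; split.
  exact: chart_img_open.
exact: chart_img_map.
Qed.

Lemma open_setI_preimage (S T : topologicalType) (f : S -> T) (U : set S)
    (V : set T) :
  open U -> open V -> (forall x, U x -> {for x, continuous f}) ->
  open (U `&` [set x | V (f x)]).
Proof.
move=> oU oV cf; rewrite openE => x [Ux Vfx].
apply: filterI; first exact: open_nbhs_nbhs.
by apply: (cf x Ux); exact: open_nbhs_nbhs.
Qed.

Lemma transition_strict_diff (R : realType) (n : nat)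
    (M : smoothManifoldType R n) (c d : chart R n M) (x : M) :
  atlas c -> atlas d -> chart_dom c x -> chart_dom d x ->
  exists L : {linear 'rV[R]_n -> 'rV[R]_n}, strict_diff (d \o chart_inv c) (c x) L.
Proof.
move=> ac ad cx dx.
have E : c @` (chart_dom c `&` chart_dom d) =
    chart_img c `&` [set u | chart_dom d (chart_inv c u)].
  apply/seteqP; split=> [_ [y [cy dy] <-]|u [[y cy <-]]].
    by split; [exact: chart_img_map|rewrite /= chart_mapK].
  by rewrite /= chart_mapK// => dy; exists y.
apply: (@C1_strict_diff _ _ _ (c @` (chart_dom c `&` chart_dom d))).
- rewrite E; apply: open_setI_preimage.
  + exact: chart_img_open.
  + exact: chart_dom_open.
  + exact: chart_inv_continuous.
- exact: (atlas_compatible _ _ ac ad 1%N).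
- by exists x.
Qed.

Lemma smooth_map_strict_diff (R : realType) (m n : nat)
    (M : smoothManifoldType R m) (N : smoothManifoldType R n) (f : M -> N)
    (c : chart R m M) (d : chart R n N) (x : M) :
  smooth_map f -> atlas c -> atlas d -> chart_dom c x -> chart_dom d (f x) ->
  exists L : {linear 'rV[R]_m -> 'rV[R]_n},
    strict_diff (d \o f \o chart_inv c) (c x) L.
Proof.
move=> [cf sf] ac ad cx dx.
apply: (@C1_strict_diff _ _ _ (chart_img c `&`
  [set u | chart_dom d (f (chart_inv c u))])).
- apply: (@open_setI_preimage _ _ (f \o chart_inv c)).
  + exact: chart_img_open.
  + exact: chart_dom_open.
  + move=> u cu; apply: continuous_comp; last exact: cf.
    exact: chart_inv_continuous.
- exact: (sf _ _ ac ad 1%N).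
- by split; [exact: chart_img_map|rewrite /= chart_mapK].
Qed.

Lemma differential_strict_diff (R : realType) (m n : nat)
    (M : smoothManifoldType R m) (N : smoothManifoldType R n) (f : M -> N)
    (x : M) : smooth_map f ->
  exists2 L : {linear 'rV[R]_m -> 'rV[R]_n},
    strict_diff (chart_at (f x) \o f \o chart_inv (chart_at x)) (chart_at x x) L &
    forall v, differential f x v = L v.
Proof.
move=> sf; have [L fL] := smooth_map_strict_diff sf (chart_at_atlas x)
  (chart_at_atlas (f x)) (chart_at_dom x) (chart_at_dom (f x)).
exists L => // v; have fv := strict_diff_is_derive v fL.
by rewrite /differential (@derive_val _ _ _ _ _ _ _ fv).
Qed.

Lemma of_coordinates_strict_diff (R : realType) (n : nat)
    (M : smoothManifoldType R n) (c : chart R n M) (x : M) :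
  atlas c -> chart_dom c x ->
  exists2 L : {linear 'rV[R]_n -> 'rV[R]_n},
    strict_diff (chart_at x \o chart_inv c) (c x) L &
    forall v, of_coordinates c x v = L v.
Proof.
move=> ac cx; have [L fL] := transition_strict_diff ac (chart_at_atlas x)
  cx (chart_at_dom x).
exists L => // v; have fv := strict_diff_is_derive v fL.
by rewrite /of_coordinates (@derive_val _ _ _ _ _ _ _ fv).
Qed.

Lemma strict_diff_id (R : realType) (V : normedModType R) (x : V) :
  strict_diff (@idfun V) x (@idfun V).
Proof.
by apply: (@strict_diff_lin _ _ _ _ _ 1) => // v; rewrite mul1r.
Qed.

Lemma of_coordinates_chart_at (R : realType) (n : nat)
    (M : smoothManifoldType R n) (x : M) (v : 'rV[R]_n) :
  of_coordinates (chart_at x) x v = v.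
Proof.
have [d d0 dP] := chart_img_near (chart_at_dom x).
have H : strict_diff (chart_at x \o chart_inv (chart_at x)) (chart_at x x) idfun.
  apply: strict_diff_near_eq (strict_diff_id _).
  by apply: (norm_lt_near d0) => y /dP/chart_invK.
have fv := strict_diff_is_derive v H.
by rewrite /of_coordinates (@derive_val _ _ _ _ _ _ _ fv).
Qed.

Lemma of_coordinates_transition (R : realType) (n : nat)
    (M : smoothManifoldType R n) (c : chart R n M) (y : M)
    (T : {linear 'rV[R]_n -> 'rV[R]_n}) (v : 'rV[R]_n) :
  atlas c -> chart_dom c y ->
  strict_diff (c \o chart_inv (chart_at y)) (chart_at y y) T ->
  of_coordinates c y (T v) = v.
Proof.
move=> ac cy TL; set c' := chart_at y in TL *.
have c'y : chart_dom c' y := chart_at_dom y.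
have [L LL ->] := of_coordinates_strict_diff ac cy.
have H : strict_diff (@idfun 'rV[R]_n) (c' y) (L \o T).
  apply: (@strict_diff_near_eq _ _ _ ((c' \o chart_inv c) \o (c \o chart_inv c'))).
    have [d d0 dP] := chart_img_near c'y.
    have [d4 d40 d4P] : exists2 d : R, 0 < d & forall u, `|u - c' y| < d ->
        chart_dom c (chart_inv c' u).
      apply: near_norm_lt; have cu := chart_inv_continuous (chart_img_map c'y).
      apply: cu; rewrite (chart_mapK c'y); apply: open_nbhs_nbhs; split=> //.
      exact: chart_dom_open.
    apply: (@norm_lt_near _ _ _ _ (Num.min d d4)); first by rewrite lt_min d0.
    move=> u; rewrite lt_min => /andP[/dP c'u /d4P cu] /=.
    by rewrite (chart_mapK cu) chart_invK.
  by apply: strict_diff_comp => //; rewrite /= (chart_mapK c'y).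
have := @derive_val _ _ _ _ _ _ _ (strict_diff_is_derive v H).
by rewrite (@derive_val _ _ _ _ _ _ _ (strict_diff_is_derive v (strict_diff_id _))).
Qed.

(** Velocities are read in [chart_at (gamma t)], which may jump with [t]; this
    expresses them through one chart valid on a whole time interval. *)
Lemma velocity_of_coordinates (R : realType) (n : nat)
    (M : smoothManifoldType R n) (gamma : R -> M) (t : R) (c : chart R n M)
    (L : {linear R -> 'rV[R]_n}) :
  {for t, continuous gamma} -> atlas c -> chart_dom c (gamma t) ->
  strict_diff (c \o gamma) t L ->
  velocity gamma t = of_coordinates c (gamma t) (L 1).
Proof.
move=> cg ac cx gL; have [L' fL' ->] := of_coordinates_strict_diff ac cx.
have H : strict_diff (chart_at (gamma t) \o gamma) t (L' \o L).
  apply: strict_diff_near_eq (strict_diff_comp gL fL').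
  have : nbhs (gamma t) (chart_dom c).
    by apply: open_nbhs_nbhs; split=> //; exact: chart_dom_open.
  move=> /cg cgt; near=> s; rewrite /= chart_mapK//.
  by near: s; exact: cgt.
have fv := strict_diff_is_derive (1 : R) H.
by rewrite /velocity (@derive_val _ _ _ _ _ _ _ fv).
Unshelve. all: by end_near. Qed.

(** * The norm of tangent vectors *)

Definition tnorm {R : realType} {n : nat} {M : smoothManifoldType R n}
  (g : riemannian_metric M) (x : M) (v : 'rV[R]_n) : R :=
  Num.sqrt (inner g x v v).

Section inner_product.
Context {R : realType} {n : nat} {M : smoothManifoldType R n}.
Implicit Types (g : riemannian_metric M) (x : M) (v w r : 'rV[R]_n).

Lemma innerDl g x v w r : inner g x (v + w) r = inner g x v r + inner g x w r.
Proof. by rewrite /inner !mulmxDl mxE. Qed.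

Lemma innerZl g x a v w : inner g x (a *: v) w = a * inner g x v w.
Proof. by rewrite /inner -!scalemxAl mxE. Qed.

Lemma innerDr g x v w r : inner g x r (v + w) = inner g x r v + inner g x r w.
Proof. by rewrite inner_sym innerDl !(inner_sym _ _ r). Qed.

Lemma innerZr g x a v w : inner g x v (a *: w) = a * inner g x v w.
Proof. by rewrite inner_sym innerZl inner_sym. Qed.

Lemma inner0l g x v : inner g x 0 v = 0.
Proof. by rewrite -(scale0r (0 : 'rV_n)) innerZl mul0r. Qed.

Lemma inner_ge0 g x v : 0 <= inner g x v v.
Proof.
by have [->|/(inner_pos g x)/ltW//] := eqVneq v 0; rewrite inner0l.
Qed.

Lemma inner_suml g x (I : Type) (s : seq I) (P : pred I) (F : I -> 'rV[R]_n) w :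
  inner g x (\sum_(i <- s | P i) F i) w = \sum_(i <- s | P i) inner g x (F i) w.
Proof.
elim/big_rec2: _ => [|i y1 y2 _ <-]; first by rewrite inner0l.
by rewrite innerDl.
Qed.

Lemma inner_sumr g x (I : Type) (s : seq I) (P : pred I) (F : I -> 'rV[R]_n) w :
  inner g x w (\sum_(i <- s | P i) F i) = \sum_(i <- s | P i) inner g x w (F i).
Proof.
by rewrite inner_sym inner_suml; apply: eq_bigr => i _; rewrite inner_sym.
Qed.

Lemma tnorm_ge0 g x v : 0 <= tnorm g x v.
Proof. exact: sqrtr_ge0. Qed.

Lemma sqr_tnorm g x v : tnorm g x v ^+ 2 = inner g x v v.
Proof. by rewrite sqr_sqrtr// inner_ge0. Qed.

(** Cauchy-Schwarz, from the positivity of the square norm of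
    [<w, w> v - <v, w> w]. *)
Lemma inner_le_tnorm g x v w : inner g x v w <= tnorm g x v * tnorm g x w.
Proof.
have [->|w0] := eqVneq w 0.
  by rewrite inner_sym inner0l mulr_ge0// tnorm_ge0.
have W := inner_pos g x w0.
have := inner_ge0 g x (inner g x w w *: v - inner g x v w *: w).
rewrite -scaleNr !(innerDl, innerDr, innerZl, innerZr) (inner_sym g x w v).
set a := inner g x v v; set b := inner g x v w; set c := inner g x w w in W *.
have -> : c * (c * a + - b * b) + (c * (- b * b) + - b * (- b * c)) =
  c * (c * a - b ^+ 2) by ring.
rewrite pmulr_rge0// subr_ge0 => H.
rewrite (le_trans (ler_norm _))// -sqrtr_sqr /tnorm -sqrtrM ?inner_ge0//.
by rewrite ler_wsqrtr// mulrC.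
Qed.

Lemma tnormD g x v w : tnorm g x (v + w) <= tnorm g x v + tnorm g x w.
Proof.
rewrite -(@ler_pXn2r _ 2)// ?nnegrE ?addr_ge0 ?tnorm_ge0//.
rewrite sqr_tnorm sqrrD !sqr_tnorm !(innerDl, innerDr) (inner_sym g x w v).
have := inner_le_tnorm g x v w; rewrite -mulr_natr.
lra.
Qed.

Lemma tnormN g x v : tnorm g x (- v) = tnorm g x v.
Proof. by rewrite /tnorm -scaleN1r innerZl innerZr !mulN1r opprK. Qed.

Lemma tnormZ g x a v : tnorm g x (a *: v) = `|a| * tnorm g x v.
Proof.
by rewrite /tnorm innerZl innerZr mulrA -expr2 sqrtrM ?sqr_ge0// sqrtr_sqr.
Qed.

Lemma tnorm_le g x : exists2 K : R, 0 < K & forall v, tnorm g x v <= K * `|v|.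
Proof.
exists (\sum_(i < n) tnorm g x (delta_mx ord0 i) + 1).
  by rewrite ltr_wpDl// sumr_ge0// => i _; exact: tnorm_ge0.
move=> v; rewrite {1}(row_sum_delta v).
apply: (@le_trans _ _ (\sum_(i < n) tnorm g x (v ord0 i *: delta_mx ord0 i))).
  elim/big_rec2: _ => [|i y1 y2 _ H]; first by rewrite /tnorm inner0l sqrtr0.
  by rewrite (le_trans (tnormD _ _ _ _))// lerD2l.
rewrite mulrDl mulr_suml; apply: ler_wpDr; first by rewrite mul1r.
apply: ler_sum => i _; rewrite tnormZ mulrC ler_wpM2l ?tnorm_ge0//.
exact: rV_coord_le_norm.
Qed.

Lemma tnormB g x v w : tnorm g x v - tnorm g x w <= tnorm g x (v - w).
Proof. by rewrite lerBlDr -{1}(subrK w v); exact: tnormD. Qed.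

Lemma tnorm_continuous g x : continuous (tnorm g x).
Proof.
have [K K0 HK] := tnorm_le g x.
move=> v; apply/continuous_norm_ltP => e e0; exists (e / K) => [|w wv].
  by rewrite divr_gt0.
have H : `|tnorm g x w - tnorm g x v| <= K * `|w - v|.
  rewrite ler_norml lerNl opprB !(le_trans (tnormB _ _ _ _))//.
  by rewrite (le_trans (HK _))// distrC.
by apply: (le_lt_trans H); rewrite mulrC -ltr_pdivlMr.
Qed.

(** By homogeneity it suffices to minimise [tnorm] on the compact unit sphere. *)
Lemma tnorm_ge g x : exists2 k : R, 0 < k & forall v, k * `|v| <= tnorm g x v.
Proof.
pose S := [set v : 'rV[R]_n | `|v| = 1].
have cS : compact S.
  apply: bounded_closed_compact.
    exists 1; split; first exact: num_real.
    by move=> r r1 v /= ->; exact: ltW.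
  apply: (@closed_comp _ _ (fun w : 'rV[R]_n => `|w|) [set 1]).
    by move=> ? _; exact: norm_continuous.
  exact: closed_eq.
have nS v : v != 0 -> S (`|v|^-1 *: v).
  move=> v0; rewrite /S/= normrZ normfV normr_id mulVf//.
  by rewrite normr_eq0.
have [[v0 Sv0]|S0] := pselect (S !=set0); last first.
  exists 1 => // v; have [->|v0] := eqVneq v 0.
    by rewrite normr0 mulr0 tnorm_ge0.
  by exfalso; apply: S0; exists (`|v|^-1 *: v); exact: nS.
have [||c cS1 cmin] := @EVT_min_rV R n (tnorm g x) S _ cS.
- by exists v0.
- exact/continuous_subspaceT/tnorm_continuous.
move: cS1; rewrite inE /S/= => c1.
have c0 : c != 0 by rewrite -normr_eq0 c1 oner_eq0.
exists (tnorm g x c); first by rewrite sqrtr_gt0 inner_pos.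
move=> v; have [->|v0'] := eqVneq v 0; first by rewrite normr0 mulr0 tnorm_ge0.
have vv : 0 < `|v| by rewrite normr_gt0.
have := cmin _ (mem_set (nS v v0')).
by rewrite tnormZ normfV normr_id mulrC ler_pdivlMr.
Qed.

End inner_product.

(** As [of_coordinates] is linear, the square norm at [y] is a quadratic form in
    [w] whose coefficients are continuous in the coordinates of [y]. *)
Lemma inner_near (R : realType) (n : nat) (M : smoothManifoldType R n)
    (g : riemannian_metric M) (x : M) (e : R) : 0 < e ->
  exists2 d : R, 0 < d & forall y, chart_dom (chart_at x) y ->
    `|chart_at x y - chart_at x x| < d -> forall w : 'rV[R]_n,
    `|inner g y (of_coordinates (chart_at x) y w) (of_coordinates (chart_at x) y w)
       - inner g x w w| <= e * `|w| ^+ 2.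
Proof.
move=> e0; set c := chart_at x.
have cx : chart_dom c x := chart_at_dom x.
have ac : atlas c := chart_at_atlas x.
pose F (i j : 'I_n) (u : 'rV[R]_n) := inner g (chart_inv c u)
  (of_coordinates c (chart_inv c u) (delta_mx ord0 i))
  (of_coordinates c (chart_inv c u) (delta_mx ord0 j)).
have n1 : 0 < (n%:R * n%:R + 1 : R) by rewrite ltr_wpDl// mulr_ge0.
pose eta := e / (n%:R * n%:R + 1).
have eta0 : 0 < eta by rewrite divr_gt0.
have /fin_all_exists2[d d0 dP] : forall ij : 'I_n * 'I_n, exists2 d : R, 0 < d &
    forall u, `|u - c x| < d -> `|F ij.1 ij.2 u - F ij.1 ij.2 (c x)| < eta.
  move=> [i j] /=.
  have [/(_ _ (chart_img_map cx)) cF _] :=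
    inner_smooth g (delta_mx ord0 i) (delta_mx ord0 j) ac 0%N.
  by move/continuous_norm_ltP : cF => /(_ _ eta0).
exists (\big[Num.min/1]_ij d ij).
  by apply/bigmin_gtP; split=> // ij _; exact: d0.
move=> y cy /bigmin_gtP[_ yd] w.
have key z : chart_dom c z ->
    inner g z (of_coordinates c z w) (of_coordinates c z w) =
    \sum_i \sum_j w ord0 i * (w ord0 j * F i j (c z)).
  move=> cz; have [L _ LE] := of_coordinates_strict_diff ac cz.
  have -> : of_coordinates c z w =
      \sum_i w ord0 i *: of_coordinates c z (delta_mx ord0 i).
    rewrite LE {1}(row_sum_delta w) linear_sum; apply: eq_bigr => i _.
    by rewrite LE linearZ.
  rewrite inner_suml; apply: eq_bigr => i _.
  rewrite inner_sumr; apply: eq_bigr => j _.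
  by rewrite innerZl innerZr /F chart_mapK.
have -> : inner g x w w = \sum_i \sum_j w ord0 i * (w ord0 j * F i j (c x)).
  by rewrite -key// !of_coordinates_chart_at.
rewrite key// -sumrB (le_trans (ler_norm_sum _ _ _))//.
apply: (@le_trans _ _ (\sum_(i < n) \sum_(j < n) `|w| * (`|w| * eta))).
  apply: ler_sum => i _; rewrite -sumrB (le_trans (ler_norm_sum _ _ _))//.
  apply: ler_sum => j _; rewrite -!mulrBr !normrM.
  rewrite ler_pM ?mulr_ge0 ?rV_coord_le_norm// ler_pM ?rV_coord_le_norm//.
  exact: ltW (dP (i, j) _ (yd (i, j) _)).
rewrite !sumr_const card_ord -mulrnA -(mulr_natl _ (n * n)) natrM.
have : 0 <= `|w| by []; move: `|w| => a a0.
have -> : n%:R * n%:R * (a * (a * eta)) = (n%:R * n%:R * eta) * a ^+ 2 by ring.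
rewrite ler_wpM2r ?sqr_ge0// /eta mulrA ler_pdivrMr// mulrC.
by rewrite ler_wpM2l ?(ltW e0)// lerDl.
Qed.

Lemma ler_sqrtr_add (R : realType) (a b s : R) :
  0 <= s -> 0 <= b -> a <= b + s ^+ 2 -> Num.sqrt a <= Num.sqrt b + s.
Proof.
move=> s0 b0 ab.
have H : 0 <= Num.sqrt b + s by rewrite addr_ge0// sqrtr_ge0.
rewrite -(ger0_norm H) -sqrtr_sqr ler_wsqrtr// (le_trans ab)//.
rewrite sqrrD sqr_sqrtr// -addrA lerD2l lerDr.
by rewrite mulrn_wge0// mulr_ge0// sqrtr_ge0.
Qed.

Lemma tnorm_near (R : realType) (n : nat) (M : smoothManifoldType R n)
    (g : riemannian_metric M) (x : M) (e : R) : 0 < e ->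
  exists2 d : R, 0 < d & forall y, chart_dom (chart_at x) y ->
    `|chart_at x y - chart_at x x| < d -> forall w : 'rV[R]_n,
    tnorm g y (of_coordinates (chart_at x) y w) <= tnorm g x w + e * `|w| /\
    tnorm g x w <= tnorm g y (of_coordinates (chart_at x) y w) + e * `|w|.
Proof.
move=> e0; have e20 : 0 < e ^+ 2 by rewrite exprn_gt0.
have [d d0 H] := inner_near g x e20.
exists d => // y cy yd w; have := H y cy yd w.
rewrite -exprMn ler_norml lerBlDl lerBrDr addrC lerBlDr => /andP[H1 H2].
by split; apply: ler_sqrtr_add; rewrite ?inner_ge0// mulr_ge0// ltW.
Qed.

(** * Speeds and lengths of curves *)

Definition speed {R : realType} {n : nat} {M : smoothManifoldType R n}
  (g : riemannian_metric M) (gamma : R -> M) (t : R) : R :=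
  tnorm g (gamma t) (velocity gamma t).

Lemma C1_curve_strict_diff (R : realType) (n : nat) (M : smoothManifoldType R n)
    (U : set R) (gamma : R -> M) (t : R) (c : chart R n M) :
  open U -> C1_curve_on U gamma -> U t -> atlas c -> chart_dom c (gamma t) ->
  exists L : {linear R -> 'rV[R]_n}, strict_diff (c \o gamma) t L.
Proof.
move=> oU [cg C1g] Ut ac ct.
apply: (@C1_strict_diff_line _ _ (U `&` [set t | chart_dom c (gamma t)])) => //.
  by apply: open_setI_preimage => //; exact: chart_dom_open.
exact: C1g.
Qed.

(** One chart around each time suffices, since the transition maps are
    strictly differentiable. *)
Lemma C1_curve_onI (R : realType) (n : nat) (M : smoothManifoldType R n)
    (U : set R) (gamma : R -> M) :
  open U ->
  (forall t, U t -> {for t, continuous gamma} /\ exists c : chart R n M,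
    [/\ atlas c, chart_dom c (gamma t) & exists L : {linear R -> 'rV[R]_n},
      strict_diff (c \o gamma) t L]) ->
  C1_curve_on U gamma.
Proof.
move=> oU H; split=> [t /H[]//|c ac]; apply: strict_diff_C1.
  by apply: open_setI_preimage; [|exact: chart_dom_open|move=> t /H[]].
move=> t [Ut ct]; have [cg [d [ad dt [L dL]]]] := H t Ut.
have [L' cL'] := transition_strict_diff ad ac dt ct.
exists (L' \o L); apply: strict_diff_near_eq (strict_diff_comp dL cL').
have : nbhs (gamma t) (chart_dom d).
  by apply: open_nbhs_nbhs; split=> //; exact: chart_dom_open.
move=> /cg cgt; near=> s; rewrite /= chart_mapK//.
by near: s; exact: cgt.
Unshelve. all: by end_near. Qed.

Lemma speed_of_coordinates (R : realType) (n : nat) (M : smoothManifoldType R n)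
    (g : riemannian_metric M) (gamma : R -> M) (t : R) (c : chart R n M)
    (L : {linear R -> 'rV[R]_n}) :
  {for t, continuous gamma} -> atlas c -> chart_dom c (gamma t) ->
  strict_diff (c \o gamma) t L ->
  speed g gamma t = tnorm g (gamma t) (of_coordinates c (gamma t) (L 1)).
Proof.
by move=> cg ac ct gL; rewrite /speed (velocity_of_coordinates cg ac ct gL).
Qed.

Lemma chart_curve_near (R : realType) (n : nat) (M : smoothManifoldType R n)
    (gamma : R -> M) (t : R) (c : chart R n M) (e : R) : 0 < e ->
  {for t, continuous gamma} -> chart_dom c (gamma t) ->
  exists2 d : R, 0 < d & forall s, `|s - t| < d ->
    chart_dom c (gamma s) /\ `|c (gamma s) - c (gamma t)| < e.
Proof.
move=> e0 cg ct.
have cc : {for t, continuous (c \o gamma)}.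
  by apply: continuous_comp => //; exact: chart_map_continuous.
have [d1 d10 d1P] := (continuous_norm_ltP _ _).1 cc e e0.
have : nbhs (gamma t) (chart_dom c).
  by apply: open_nbhs_nbhs; split=> //; exact: chart_dom_open.
move=> /cg /near_norm_lt[d2 d20 d2P].
exists (Num.min d1 d2); first by rewrite lt_min d10.
by move=> s; rewrite lt_min => /andP[/d1P ? /d2P].
Qed.

(** Around time [t] the speed is the norm of the coordinate derivative in the
    fixed chart at [gamma t]: combine the continuity of that derivative with
    [tnorm_near]. *)
Lemma speed_continuous (R : realType) (n : nat) (M : smoothManifoldType R n)
    (g : riemannian_metric M) (U : set R) (gamma : R -> M) (t : R) :
  open U -> C1_curve_on U gamma -> U t -> {for t, continuous (speed g gamma)}.
Proof.
move=> oU C1g Ut; have [cg _] := C1g.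
set x := gamma t; set c := chart_at x.
have ct : chart_dom c x := chart_at_dom x.
have ac : atlas c := chart_at_atlas x.
pose D s := 'D_1 (c \o gamma) s.
have spE s : U s -> chart_dom c (gamma s) ->
    speed g gamma s = tnorm g (gamma s) (of_coordinates c (gamma s) (D s)).
  move=> Us cs; have [L cL] := C1_curve_strict_diff oU C1g Us ac cs.
  have DL := strict_diff_is_derive (1 : R) cL.
  rewrite (speed_of_coordinates g (cg s Us) ac cs cL).
  by rewrite /D (@derive_val _ _ _ _ _ _ _ DL).
have cD : {for t, continuous D}.
  apply: strict_diff_derive_continuous.
  have [d d0 dP] := chart_curve_near ltr01 (cg t Ut) ct.
  have [d2 d20 d2U] := near_norm_lt (open_nbhs_nbhs (conj oU Ut)).
  apply: (@norm_lt_near _ _ _ _ (Num.min d d2)); first by rewrite lt_min d0.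
  move=> s; rewrite lt_min => /andP[/dP[cs _] /d2U Us].
  exact: C1_curve_strict_diff oU C1g Us ac cs.
apply/continuous_norm_ltP => e e0.
have [K K0 HK] := tnorm_le g x.
have D1 : 0 < `|D t| + 1 by rewrite ltr_wpDl.
pose e1 := e / 4 / (`|D t| + 1).
have e10 : 0 < e1 by rewrite !divr_gt0.
have [d1 d10 d1P] := tnorm_near g x e10.
have [d2 d20 d2P] := chart_curve_near d10 (cg t Ut) ct.
pose e3 := Num.min 1 (e / 4 / K).
have e30 : 0 < e3 by rewrite lt_min !divr_gt0// ltr01.
have [d3 d30 d3P] := (continuous_norm_ltP _ _).1 cD e3 e30.
have [d4 d40 d4U] := near_norm_lt (open_nbhs_nbhs (conj oU Ut)).
exists (Num.min d2 (Num.min d3 d4)); first by rewrite !lt_min d20 d30.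
move=> s; rewrite !lt_min => /and3P[/d2P[cs cst] /d3P Ds /d4U Us].
have [A1 A2] := d1P _ cs cst (D s).
rewrite (spE s Us cs) (spE t Ut ct) of_coordinates_chart_at.
have B1 := tnormB g x (D s) (D t).
have B2 := tnormB g x (D t) (D s).
have C1 : tnorm g x (D s - D t) <= e / 4.
  rewrite (le_trans (HK _))//.
  have : `|D s - D t| <= e / 4 / K by rewrite ltW// (lt_le_trans Ds)// ge_min lexx orbT.
  by rewrite ler_pdivlMr// mulrC.
have C2 : tnorm g x (D t - D s) <= e / 4 by rewrite -opprB tnormN.
have E1 : e1 * `|D s| <= e / 4.
  have : `|D s| <= `|D t| + 1.
    rewrite -[D s](subrK (D t)) (le_trans (ler_normD _ _))// addrC lerD2l ltW//.
    by rewrite (lt_le_trans Ds)// ge_min lexx.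
  move=> H; apply: (@le_trans _ _ (e1 * (`|D t| + 1))).
    by rewrite ler_wpM2l// ltW.
  by rewrite /e1 divfK// gt_eqF.
have F1 := le_trans B1 C1; have F2 := le_trans B2 C2.
suff H (p1 p4 p5 p6 : R) : p1 <= p5 + p6 -> p5 <= p1 + p6 -> p5 - p4 <= e / 4 ->
    p4 - p5 <= e / 4 -> p6 <= e / 4 -> `|p1 - p4| < e.
  exact: H A1 A2 F1 F2 E1.
clear -e0 => *; by rewrite ltr_norml; apply/andP; split; lra.
Qed.

(** The supremum of the points [s] with [P a s] is attained and cannot be less
    than [b], by the local hypothesis around it. *)
Lemma interval_additive (R : realType) (P : R -> R -> Prop) (a b : R) :
  a <= b ->
  (forall s m s', a <= s <= m -> m <= s' <= b -> P s m -> P m s' -> P s s') ->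
  (forall t, a <= t <= b -> exists2 d : R, 0 < d & forall s s',
     a <= s <= t -> t <= s' <= b -> t - s < d -> s' - t < d -> P s s') ->
  P a b.
Proof.
move=> ab Pchain Ploc.
pose S := [set s | a <= s <= b /\ P a s].
have Sa : S a.
  have [|d d0 dP] := Ploc a; first by rewrite lexx.
  by split; [rewrite lexx|apply: dP; rewrite ?lexx ?subrr].
have hS : has_sup S by split; [exists a|exists b => s [/andP[]]].
pose T := sup S.
have aT : a <= T by exact: sup_upper_bound hS _ Sa.
have Tb : T <= b by apply: ge_sup; [exists a|move=> s [/andP[]]].
have [|d d0 dP] := Ploc T; first by rewrite aT.
have [s [/andP[as_ sb] Pas] Ts] := sup_adherent d0 hS.
have sT : s <= T by apply: sup_upper_bound hS _ _; split=> //; rewrite as_.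
pose T' := Num.min b (T + d / 2).
have T'b : T' <= b by rewrite ge_min lexx.
have TT' : T <= T' by rewrite le_min Tb lerDl divr_ge0 ?(ltW d0).
have T'd : T' - T < d.
  have : T' <= T + d / 2 by rewrite ge_min lexx orbT.
  by move=> ?; lra.
have PaT' : P a T'.
  apply: (Pchain a s T'); rewrite ?lexx ?as_ ?T'b ?(le_trans sT)//.
  apply: dP => //; rewrite ?as_ ?TT' ?T'b//.
  by move: Ts; rewrite -/T => ?; lra.
have [E|] := eqVneq T' b; first by rewrite -E.
have : T' <= T.
  by apply: sup_upper_bound hS _ _; split=> //; rewrite T'b (le_trans aT).
rewrite /T' minEle; case: ifP => _; last by move=> ?; lra.
by rewrite eqxx.
Qed.

Lemma Rintegral_ge_cst (R : realType) (f : R -> R) (a s s' b m : R) :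
  {within `[a, b], continuous f} -> a <= s -> s <= s' -> s' <= b ->
  (forall t, s <= t <= s' -> m <= f t) ->
  m * (s' - s) <= \int[lebesgue_measure]_(t in `[a, s']) f t -
                  \int[lebesgue_measure]_(t in `[a, s]) f t.
Proof.
move=> cf as_ ss' s'b mf.
have iab : lebesgue_measure.-integrable `[a, b] (EFin \o f).
  by apply: continuous_compact_integrable => //; exact: segment_compact.
have ias : lebesgue_measure.-integrable `[a, s'] (EFin \o f).
  by apply: integrableS iab => //; apply: subset_itvl; rewrite bnd_simp.
rewrite (Rintegral_itvB ias) ?bnd_simp//.
have iss : lebesgue_measure.-integrable `]s, s'] (EFin \o f).
  by apply: integrableS iab => //; apply: subset_itv; rewrite bnd_simp.
have ms : lebesgue_measure `]s, s'] = (s' - s)%:E :> \bar R.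
  rewrite lebesgue_measure_itv/= lte_fin; case: ltP => // s's.
  by have -> : s' = s; [apply/eqP; rewrite eq_le ss' s's|rewrite subrr].
have <- : \int[lebesgue_measure]_(t in `]s, s']) m = m * (s' - s).
  by rewrite Rintegral_cst//= ms.
apply: le_Rintegral => //.
  have : lebesgue_measure.-integrable `[a, b] (EFin \o (cst m : R -> R)).
    apply: continuous_compact_integrable; first exact: segment_compact.
    exact/continuous_subspaceT/cst_continuous.
  by apply: integrableS => //; apply: subset_itv; rewrite bnd_simp.
by move=> t /=; rewrite in_itv/= => /andP[st ts]; apply: mf; rewrite (ltW st).
Qed.

(** * Two-point functions dominated by a metric *)

(** The triangle inequality for an extended-real two-point function, stated on
    real upper bounds so that no value of the function has to be excluded. *)
Definition triangular {R : realType} {T : Type} (E : T -> T -> \bar R) :=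
  forall x y z (r s : R), (E x y <= r%:E)%E -> (E y z <= s%:E)%E ->
    (E x z <= (r + s)%:E)%E.

(** The bound is required in both orders of the arguments because [E] need not
    be symmetric, and only in the chart [chart_at x], where [tnorm g x] reads
    coordinate vectors directly. *)
Definition dominated {R : realType} {n : nat} {M : smoothManifoldType R n}
    (g : riemannian_metric M) (E : M -> M -> \bar R) :=
  forall x (e : R), 0 < e -> exists2 d : R, 0 < d &
    forall y, chart_dom (chart_at x) y ->
      let v := chart_at x y - chart_at x x in
      `|v| < d -> (E x y <= (tnorm g x v + e * `|v|)%:E)%E /\
                  (E y x <= (tnorm g x v + e * `|v|)%:E)%E.

Lemma dominated_refl (R : realType) (n : nat) (M : smoothManifoldType R n)
    (g : riemannian_metric M) (E : M -> M -> \bar R) (x : M) :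
  dominated g E -> (E x x <= 0)%E.
Proof.
move=> /(_ x 1 ltr01)[d d0 /(_ x (chart_at_dom x))].
rewrite /= subrr normr0 => /(_ d0)[+ _].
by rewrite mulr0 addr0 /tnorm inner0l sqrtr0.
Qed.

Lemma dominated_curve (R : realType) (n : nat) (M : smoothManifoldType R n)
    (g : riemannian_metric M) (E : M -> M -> \bar R) (U : set R)
    (gamma : R -> M) (t e : R) :
  dominated g E -> open U -> C1_curve_on U gamma -> U t -> 0 < e ->
  exists2 d : R, 0 < d & forall s, `|s - t| < d ->
    (E (gamma t) (gamma s) <= ((speed g gamma t + e) * `|s - t|)%:E)%E /\
    (E (gamma s) (gamma t) <= ((speed g gamma t + e) * `|s - t|)%:E)%E.
Proof.
move=> dE oU C1g Ut e0; have [cg _] := C1g.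
set x := gamma t; set c := chart_at x.
have ct : chart_dom c x := chart_at_dom x.
have ac : atlas c := chart_at_atlas x.
have [L gL] := C1_curve_strict_diff oU C1g Ut ac ct.
have spE : speed g gamma t = tnorm g x (L 1).
  by rewrite (speed_of_coordinates g (cg t Ut) ac ct gL) of_coordinates_chart_at.
have [K K0 HK] := tnorm_le g x.
have L1 : 0 < `|L 1| + 1 by rewrite ltr_wpDl.
pose e1 := e / 2 / (`|L 1| + 1).
have e10 : 0 < e1 by rewrite !divr_gt0.
have [d1 d10 d1P] := dE x e1 e10.
pose e2 := Num.min 1 (e / 2 / K).
have e20 : 0 < e2 by rewrite lt_min !divr_gt0// ltr01.
have [d2 d20 d2P] := gL.2 e2 e20.
have [d3 d30 d3P] := chart_curve_near d10 (cg t Ut) ct.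
exists (Num.min d2 d3); first by rewrite lt_min d20.
move=> s; rewrite lt_min => /andP[sd2 /d3P[cs cst]].
have := d2P s t sd2; rewrite subrr normr0 => /(_ d20) /= A.
have L1s : L (s - t) = (s - t) *: L 1 by rewrite -linearZZ [(s - t)%:A]mulr1.
set v := c (gamma s) - c x in A *.
have vn : `|v| <= (`|L 1| + 1) * `|s - t|.
  rewrite -[v](subrK (L (s - t))) (le_trans (ler_normD _ _))//.
  rewrite L1s normrZ mulrDl addrC mulrC lerD2l.
  by move: A; rewrite L1s => /le_trans; apply; rewrite ler_wpM2r// ge_min lexx.
have tv : tnorm g x v <= (speed g gamma t + e / 2) * `|s - t|.
  rewrite -[v](subrK (L (s - t))) (le_trans (tnormD _ _ _ _))//.
  rewrite mulrDl addrC L1s tnormZ spE mulrC lerD2l (le_trans (HK _))//.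
  move: A; rewrite L1s => A.
  apply: (@le_trans _ _ (K * (e / 2 / K * `|s - t|))).
    rewrite ler_wpM2l ?(ltW K0)// (le_trans A)// ler_wpM2r// ge_min lexx orbT//.
  by rewrite mulrA mulrCA divff ?gt_eqF// mulr1.
have ev : e1 * `|v| <= e / 2 * `|s - t|.
  apply: (@le_trans _ _ (e1 * ((`|L 1| + 1) * `|s - t|))).
    by rewrite ler_wpM2l// ltW.
  by rewrite mulrA /e1 divfK// gt_eqF.
have fin : tnorm g x v + e1 * `|v| <= (speed g gamma t + e) * `|s - t|.
  apply: (le_trans (lerD tv ev)); rewrite -mulrDl -addrA -splitr//.
have [B1 B2] := d1P _ cs cst.
by split; [apply: le_trans B1 _|apply: le_trans B2 _]; rewrite lee_fin.
Qed.

(** On a short interval around [t], [E] is at most and the integral of the speed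
    is at least [speed t] times the length of the interval, up to an arbitrarily
    small fraction of that length; chain these estimates by
    [interval_additive]. *)
Lemma dominated_arc (R : realType) (n : nat) (M : smoothManifoldType R n)
    (g : riemannian_metric M) (E : M -> M -> \bar R) (U : set R)
    (gamma : R -> M) (a b : R) :
  triangular E -> dominated g E -> open U -> C1_curve_on U gamma ->
  a <= b -> `[a, b] `<=` U ->
  (E (gamma a) (gamma b) <=
    (\int[lebesgue_measure]_(t in `[a, b]) speed g gamma t)%:E)%E.
Proof.
move=> tE dE oU C1g ab abU.
have cs (t : R) : a <= t <= b -> {for t, continuous (speed g gamma)}.
  move=> tab; have Ut : U t by apply: abU; rewrite /= in_itv.
  exact: (speed_continuous oU C1g Ut).
have csw : {within `[a, b], continuous (speed g gamma)}.
  by apply: continuous_in_subspaceT => t; rewrite inE/= in_itv/=; exact: cs.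
pose F s := \int[lebesgue_measure]_(t in `[a, s]) speed g gamma t.
apply/lee_addgt0Pr => e e0.
have ba1 : 0 < b - a + 1 by rewrite ltr_wpDl// subr_ge0.
have [e1 e10 e1E] : exists2 e1 : R, 0 < e1 & 2 * e1 * (b - a) <= e.
  exists (e / (b - a + 1) / 2); first by rewrite !divr_gt0.
  have -> : 2 * (e / (b - a + 1) / 2) * (b - a) = e * (b - a) / (b - a + 1).
    by field; rewrite gt_eqF.
  by rewrite ler_pdivrMr// ler_wpM2l ?(ltW e0)// lerDl.
have : (E (gamma a) (gamma b) <= (F b - F a + 2 * e1 * (b - a))%:E)%E.
  pose P s s' := (E (gamma s) (gamma s') <= (F s' - F s + 2 * e1 * (s' - s))%:E)%E.
  apply: (@interval_additive _ P a b ab).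
    move=> s m s' _ _ sm ms'; have := tE _ _ _ _ _ sm ms'.
    by congr (_ <= _%:E)%E; ring.
  move=> t /[dup] tab /andP[at_ tb].
  have Ut : U t by apply: abU; rewrite /= in_itv.
  have [d1 d10 d1P] := dominated_curve dE oU C1g Ut e10.
  have [d2 d20 d2P] := (continuous_norm_ltP _ _).1 (cs t tab) e1 e10.
  exists (Num.min d1 d2); first by rewrite lt_min d10.
  move=> s s' /andP[as_ st] /andP[ts' s'b]; rewrite !lt_min => /andP[s1 s2] /andP[s'1 s'2].
  have [_ A] : (E (gamma t) (gamma s) <= ((speed g gamma t + e1) * `|s - t|)%:E)%E /\
    (E (gamma s) (gamma t) <= ((speed g gamma t + e1) * `|s - t|)%:E)%E.
    by apply: d1P; rewrite distrC ger0_norm// subr_ge0.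
  have [B _] : (E (gamma t) (gamma s') <= ((speed g gamma t + e1) * `|s' - t|)%:E)%E /\
    (E (gamma s') (gamma t) <= ((speed g gamma t + e1) * `|s' - t|)%:E)%E.
    by apply: d1P; rewrite ger0_norm// subr_ge0.
  have C : (speed g gamma t - e1) * (s' - s) <= F s' - F s.
    apply: (Rintegral_ge_cst csw) => //; first exact: le_trans ts'.
    move=> r /andP[sr rs'].
    have : `|speed g gamma r - speed g gamma t| < e1.
      apply: d2P; rewrite ltr_norml; apply/andP; split.
        by rewrite ltrNl opprB (le_lt_trans _ s2)// lerD2l lerN2.
      by rewrite (le_lt_trans _ s'2)// lerD2r.
    by rewrite ltr_distl => /andP[/ltW].
  apply: (le_trans (tE _ _ _ _ _ A B)); rewrite lee_fin.
  rewrite distrC !ger0_norm ?subr_ge0//.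
  clear -C; move: (F s') (F s) (speed g gamma t) C => F1 F2 sp C; lra.
have Fa : F a = 0 by rewrite /F set_itv1 Rintegral_set1.
by rewrite Fa subr0 => /le_trans; apply; rewrite -EFinD lee_fin lerD2l.
Qed.

(** * Piecewise C^1 curves *)

Lemma speed_near_eq (R : realType) (n : nat) (M : smoothManifoldType R n)
    (g : riemannian_metric M) (gamma delta : R -> M) (t : R) :
  (\forall s \near t, gamma s = delta s) -> speed g gamma t = speed g delta t.
Proof.
move=> H; have E := nbhs_singleton H; rewrite /speed /velocity E.
congr tnorm; apply: near_eq_derive.
by near=> s; rewrite /=; congr (_ _); near: s.
Unshelve. all: by end_near. Qed.

Lemma arc_integrable (R : realType) (n : nat) (M : smoothManifoldType R n)
    (g : riemannian_metric M) (U : set R) (delta : R -> M) (a b : R) :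
  open U -> C1_curve_on U delta -> `[a, b] `<=` U ->
  lebesgue_measure.-integrable `[a, b] (EFin \o speed g delta).
Proof.
move=> oU C1d abU; apply: continuous_compact_integrable.
  exact: segment_compact.
apply: continuous_in_subspaceT => t; rewrite inE => /abU Ut.
exact: (speed_continuous oU C1d Ut).
Qed.

(** At the ends of an arc the velocity of [gamma] depends on its germ beyond
    the arc and may even be meaningless; this affects a null set only. *)
Lemma arc_integral (R : realType) (n : nat) (M : smoothManifoldType R n)
    (g : riemannian_metric M) (U : set R) (gamma delta : R -> M) (a b : R) :
  open U -> C1_curve_on U delta -> `[a, b] `<=` U ->
  {in `[a, b], gamma =1 delta} ->
  measurable_fun `[a, b] (speed g gamma) /\
  (\int[lebesgue_measure]_(t in `[a, b]) (speed g gamma t)%:E =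
   (\int[lebesgue_measure]_(t in `[a, b]) speed g delta t)%:E)%E.
Proof.
move=> oU C1d abU gd.
have spE : {in `]a, b[%classic, speed g delta =1 speed g gamma}.
  move=> t; rewrite inE/= => tab; apply: speed_near_eq.
  near=> s; apply/esym/gd; near: s.
  have : nbhs t `]a, b[%classic by apply: open_nbhs_nbhs; split=> //; exact: itv_open.
  apply: filterS => s /=; exact: subset_itv_oo_cc.
have id := arc_integrable g oU C1d abU.
have md : measurable_fun (`]a, b[%classic : set R) (speed g delta).
  apply: (@measurable_funS _ _ _ _ `[a, b]) => //; first exact: subset_itv_oo_cc.
  by apply/measurable_EFinP; exact: (measurable_int lebesgue_measure).
have mg : measurable_fun (`]a, b[%classic : set R) (speed g gamma).
  exact: eq_measurable_fun spE md.
split; first exact: measurable_fun_itv_cc mg.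
rewrite /Rintegral fineK; last by apply: integrable_fin_num.
have Ed := @integral_itv_bndoo R a b (EFin \o speed g delta) true false
  ((measurable_EFinP _ _).2 md).
have Eg := @integral_itv_bndoo R a b (EFin \o speed g gamma) true false
  ((measurable_EFinP _ _).2 mg).
apply: (etrans Eg); apply: etrans (esym Ed).
by apply: eq_integral => t /spE /= ->.
Unshelve. all: by end_near. Qed.

(** [polyarc g a b gamma L]: on [a, b] the curve is a finite chain of C^1 arcs
    of total length [L].  Keeping the chain and its length together makes
    concatenation and reparametrisation inductions on the number of arcs. *)
Inductive polyarc {R : realType} {n : nat} {M : smoothManifoldType R n}
    (g : riemannian_metric M) (a : R) : R -> (R -> M) -> R -> Prop :=
| polyarc_nil gamma : polyarc g a a gamma 0
| polyarc_cons b c gamma L (U : set R) (delta : R -> M) :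
    polyarc g a b gamma L -> b < c -> open U -> `[b, c] `<=` U ->
    C1_curve_on U delta -> {in `[b, c], gamma =1 delta} ->
    polyarc g a c gamma
      (L + \int[lebesgue_measure]_(t in `[b, c]) speed g delta t).

Section polyarc_theory.
Context {R : realType} {n : nat} {M : smoothManifoldType R n}.
Variable g : riemannian_metric M.
Implicit Types (a b c L : R) (gamma : R -> M).

Lemma polyarc_le a b gamma L : polyarc g a b gamma L -> a <= b.
Proof.
by elim=> // {}b c _ _ _ _ _ ab bc _ _ _ _; exact: le_trans (ltW bc).
Qed.

Lemma polyarc_length a b gamma L : polyarc g a b gamma L ->
  measurable_fun `[a, b] (speed g gamma) /\
  (\int[lebesgue_measure]_(t in `[a, b]) (speed g gamma t)%:E = L%:E)%E.
Proof.
elim=> [{}gamma|{}b c {}gamma {}L U delta pL [mL iL] bc oU bcU C1d gd].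
  by rewrite set_itv1 integral_set1; split=> //; exact: measurable_fun_set1.
have [mbc ibc] := arc_integral g oU C1d bcU gd.
have E : `[a, c]%classic = `[a, b]%classic `|` `]b, c]%classic :> set R.
  by rewrite -itv_bndbnd_setU// bnd_simp ?(polyarc_le pL)// ltW.
have mbc' : measurable_fun `]b, c] (speed g gamma).
  by apply: measurable_funS mbc => //; apply: subset_itvr; rewrite bnd_simp.
have mac : measurable_fun `[a, c] (speed g gamma).
  by rewrite E; apply/measurable_funU => //.
split=> //; rewrite E ge0_integral_setU//=.
- rewrite iL integral_itv_obnd_cbnd ?ibc//.
  exact/measurable_EFinP.
- by rewrite -E; exact/measurable_EFinP.
- by move=> t _; rewrite lee_fin tnorm_ge0.
- apply/disj_setPS => t [/=]; rewrite !in_itv/= => /andP[_ tb] /andP[bt _].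
  by move: bt; rewrite ltNge tb.
Qed.

Lemma polyarc_eq a b gamma gamma' L : {in `[a, b], gamma =1 gamma'} ->
  polyarc g a b gamma L -> polyarc g a b gamma' L.
Proof.
move=> gg' pL; elim: pL gamma' gg' => [*|{}b c {}gamma {}L U delta pL IH bc oU bcU C1d gd gamma' gg'].
  exact: polyarc_nil.
have ab := polyarc_le pL.
apply: (@polyarc_cons _ _ _ _ _ b c gamma' L U delta) => //.
  apply: IH => t tab; apply: gg'; move: tab; rewrite !in_itv/= => /andP[-> tb].
  by rewrite (le_trans tb)// ltW.
move=> t tbc; rewrite -gd// gg'//; move: tbc; rewrite !in_itv/= => /andP[bt ->].
by rewrite (le_trans ab).
Qed.

Lemma polyarc_cat a b c gamma L L' : polyarc g a b gamma L ->
  polyarc g b c gamma L' -> polyarc g a c gamma (L + L').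
Proof.
move=> pL pL'; elim: pL' pL => [{}gamma|b' {}c {}gamma {}L' U delta _ IH bc oU bcU C1d gd] pL.
  by rewrite addr0.
by rewrite addrA; apply: (@polyarc_cons _ _ _ _ _ b' c gamma _ U delta) => //; exact: IH.
Qed.

Lemma polyarc_arc a b gamma (U : set R) : a < b -> open U -> `[a, b] `<=` U ->
  C1_curve_on U gamma ->
  polyarc g a b gamma (\int[lebesgue_measure]_(t in `[a, b]) speed g gamma t).
Proof.
move=> ab oU abU C1g; rewrite -[X in polyarc _ _ _ _ X]add0r.
by apply: (@polyarc_cons _ _ _ _ _ a b gamma _ U gamma) => //; exact: polyarc_nil.
Qed.

Lemma piecewise_C1_polyarc gamma : piecewise_C1 gamma ->
  exists L, polyarc g 0 1 gamma L.
Proof.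
move=> [N [t [t0 [tN H]]]]; rewrite -tN.
suff K i : (i <= N)%N -> exists L, polyarc g 0 (t i) gamma L by exact: K.
elim: i => [_|i IH iN]; first by exists 0; rewrite t0; exact: polyarc_nil.
have [L pL] := IH (ltnW iN).
have [tt [U [delta [oU [tU [C1d gd]]]]]] := H i iN.
by eexists; exact: (polyarc_cons pL tt oU tU C1d gd).
Qed.

Lemma polyarc_pieces a b gamma L : polyarc g a b gamma L ->
  exists (N : nat) (t : nat -> R), t 0%N = a /\ t N = b /\
    forall i, (i < N)%N -> t i < t i.+1 /\
      exists (U : set R) (delta : R -> M),
        open U /\ `[t i, t i.+1] `<=` U /\ C1_curve_on U delta /\
        {in `[t i, t i.+1], gamma =1 delta}.
Proof.
elim=> [{}gamma|{}b c {}gamma {}L U delta _ [N [t [t0 [tN H]]]] bc oU bcU C1d gd].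
  by exists 0%N, (fun=> a).
exists N.+1, (fun i => if (i <= N)%N then t i else c); split=> //; split.
  by rewrite ltnn.
move=> i; rewrite ltnS => iN; rewrite iN; move: iN; rewrite leq_eqVlt.
move=> /orP[/eqP->|iN]; last by rewrite iN; exact: H.
by rewrite ltnn tN; split=> //; exists U, delta.
Qed.

Lemma polyarc_dominated (E : M -> M -> \bar R) a b gamma L :
  triangular E -> dominated g E -> polyarc g a b gamma L ->
  (E (gamma a) (gamma b) <= L%:E)%E.
Proof.
move=> tE dE; elim=> [{}gamma|{}b c {}gamma {}L U delta pL IH bc oU bcU C1d gd].
  exact: dominated_refl dE.
apply: (tE _ _ _ _ _ IH); have := dominated_arc tE dE oU C1d (ltW bc) bcU.
by rewrite !gd// in_itv/= lexx ltW.
Qed.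

Lemma polyarc_distance gamma L : polyarc g 0 1 gamma L ->
  (riemannian_distance g (gamma 0%R) (gamma 1%R) <= L%:E)%E.
Proof.
move=> pL; have [_ <-] := polyarc_length pL.
apply: ereal_inf_lbound; exists gamma => //; split=> //.
exact: polyarc_pieces pL.
Qed.

Lemma distance_polyarc x y (r : R) : (riemannian_distance g x y < r%:E)%E ->
  exists gamma L, [/\ polyarc g 0 1 gamma L, gamma 0 = x, gamma 1 = y & L < r].
Proof.
move=> /ereal_inf_lt[_ [gamma [/piecewise_C1_polyarc[L pL] [g0 g1]] <-]].
have [_ iL] := polyarc_length pL; rewrite /curve_length iL lte_fin => Lr.
by exists gamma, L.
Qed.

(** The comparison principle: along a piecewise C^1 curve the bounds of [E] by
    the lengths of the arcs add up by the triangle inequality. *)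
Lemma dominated_le_distance (E : M -> M -> \bar R) x y :
  triangular E -> dominated g E -> (E x y <= riemannian_distance g x y)%E.
Proof.
move=> tE dE; apply: le_ereal_inf_tmp => _ [gamma [/piecewise_C1_polyarc[L pL] [<- <-]] <-].
have [_ iL] := polyarc_length pL; rewrite /curve_length iL.
exact: polyarc_dominated pL.
Qed.

(** * Concatenation and the triangle inequality *)

Lemma C1_curve_affine (U : set R) gamma (al be : R) :
  open U -> C1_curve_on U gamma ->
  let V := [set s | U (al * s + be)] in
  [/\ open V, C1_curve_on V (fun s => gamma (al * s + be)) &
    forall s, V s -> speed g (fun s => gamma (al * s + be)) s =
      `|al| * speed g gamma (al * s + be)].
Proof.
move=> oU C1g V; have [cg _] := C1g.
have ca : continuous (fun s : R => al * s + be).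
  by move=> s; apply: cvgD; [apply: cvgM; [exact: cvg_cst|exact: cvg_id]|exact: cvg_cst].
have oV : open V by have := (continuousP _).1 ca _ oU.
have cga s : V s -> {for s, continuous (fun s => gamma (al * s + be))}.
  by move=> Vs; apply: (@continuous_comp _ _ _ (fun s : R => al * s + be)); [exact: ca|exact: cg].
have lA : linear (fun s : R => al * s).
  by move=> k x y; rewrite mulrDr /GRing.scale/= mulrCA.
pose A : {linear R -> R} := HB.pack (fun s : R => al * s)
  (GRing.isLinear.Build R R R _ _ lA).
have dA s : strict_diff (fun s : R => al * s + be) s A.
  split; last first.
    by move=> e e0; exists 1 => // y z _ _; rewrite /= opprD addrACA subrr addr0
      -mulrBr subrr normr0 mulr_ge0// ltW.
  exists (`|al| + 1); first by rewrite ltr_wpDl.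
  by move=> v /=; rewrite normrM ler_wpM2r// lerDl.
have key s : V s -> exists2 L : {linear R -> 'rV[R]_n},
    strict_diff (chart_at (gamma (al * s + be)) \o gamma) (al * s + be) L &
    strict_diff (chart_at (gamma (al * s + be)) \o (fun s => gamma (al * s + be))) s (L \o A).
  move=> Vs; have [L gL] := C1_curve_strict_diff oU C1g Vs (chart_at_atlas _) (chart_at_dom _).
  by exists L => //; exact: (strict_diff_comp (dA s) gL).
split=> //.
  apply: C1_curve_onI => // s Vs; split; first exact: cga.
  exists (chart_at (gamma (al * s + be))); split; [exact: chart_at_atlas|exact: chart_at_dom|].
  by have [L _ H] := key s Vs; exists (L \o A).
move=> s Vs; have [L gL gLA] := key s Vs.
rewrite (speed_of_coordinates g (cga s Vs) (chart_at_atlas _) (chart_at_dom _) gLA).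
rewrite (speed_of_coordinates g (cg _ Vs) (chart_at_atlas _) (chart_at_dom _) gL).
rewrite !of_coordinates_chart_at /= mulr1 -tnormZ -linearZZ.
by rewrite [al%:A]mulr1.
Qed.

Lemma integral_affine (f : R -> R) (al be a b : R) : 0 < al -> a < b ->
  {within `[al * a + be, al * b + be], continuous f} ->
  \int[lebesgue_measure]_(t in `[al * a + be, al * b + be]) f t =
  \int[lebesgue_measure]_(s in `[a, b]) (al * f (al * s + be)).
Proof.
move=> al0 ab cf; rewrite /Rintegral; congr fine.
pose F s : R := al * s + be.
have ca : continuous F.
  by move=> s; apply: cvgD; [apply: cvgM; [exact: cvg_cst|exact: cvg_id]|exact: cvg_cst].
have dF s : is_derive s (1 : R) F al.
  by rewrite /F; apply: is_derive_eq; rewrite /GRing.scale/= !(mulr0, mulr1, addr0, add0r).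
have F'E : (F^`())%classic = cst al.
  by apply/funext => s; rewrite derive1E (@derive_val _ _ _ _ _ _ _ (dF s)).
rewrite (@integration_by_substitution_increasing R F f a b (ltW ab)) ?F'E//.
- by apply: eq_integral => s _; rewrite /= mulrC.
- by move=> s s' _ _ ss'; rewrite ltrD2r ltr_pM2l.
- by move=> s _; exact: cst_continuous.
- exact: is_cvg_cst.
- exact: is_cvg_cst.
- split; first by move=> s _; exact: (@ex_derive _ _ _ _ _ _ _ (dF s)).
  + exact/cvg_at_right_filter/ca.
  + exact/cvg_at_left_filter/ca.
Qed.

Lemma polyarc_affine (al be a b : R) gamma L : 0 < al ->
  polyarc g a b gamma L ->
  polyarc g ((a - be) / al) ((b - be) / al) (fun s => gamma (al * s + be)) L.
Proof.
move=> al0; elim=> [{}gamma|{}b c {}gamma {}L U delta pL IH bc oU bcU C1d gd].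
  exact: polyarc_nil.
have K s : al * ((s - be) / al) + be = s by rewrite mulrC divfK ?gt_eqF// subrK.
have [oV C1V spV] := C1_curve_affine al be oU C1d.
have bc' : (b - be) / al < (c - be) / al by rewrite ltr_pM2r ?invr_gt0// ltrD2r.
have memE s : (b - be) / al <= s <= (c - be) / al -> b <= al * s + be <= c.
  by rewrite ler_pdivrMr// ler_pdivlMr// lerBlDr lerBrDr mulrC.
have sV : `[(b - be) / al, (c - be) / al] `<=` [set s | U (al * s + be)].
  by move=> s /=; rewrite in_itv/= => /memE ?; apply: bcU; rewrite /= in_itv.
have -> : \int[lebesgue_measure]_(t in `[b, c]) speed g delta t =
  \int[lebesgue_measure]_(s in `[(b - be) / al, (c - be) / al])
     speed g (fun s => delta (al * s + be)) s.
  rewrite -{1}(K b) -{1}(K c) integral_affine//.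
    apply: eq_Rintegral => s; rewrite inE => /sV Vs.
    by rewrite spV// gtr0_norm.
  apply: continuous_in_subspaceT => t; rewrite inE !K => /bcU Ut.
  exact: (speed_continuous oU C1d Ut).
apply: (polyarc_cons IH bc' oV sV C1V).
by move=> s; rewrite in_itv/= => /memE ?; rewrite gd// in_itv.
Qed.

(** Run through two almost minimising curves at double speed. *)
Lemma distance_triangular : triangular (riemannian_distance g).
Proof.
move=> x y z r s xy yz; apply/lee_addgt0Pr => e e0.
have e20 : 0 < e / 2 by rewrite divr_gt0.
have [|g1 [L1 [p1 g10 g11 L1r]]] := @distance_polyarc x y (r + e / 2).
  by rewrite (le_lt_trans xy)// lte_fin ltrDl.
have [|g2 [L2 [p2 g20 g21 L2r]]] := @distance_polyarc y z (s + e / 2).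
  by rewrite (le_lt_trans yz)// lte_fin ltrDl.
pose gamma (t : R) := if t <= 1 / 2 then g1 (2 * t + 0) else g2 (2 * t + (- 1)).
have h20 : (0 : R) < 2 by [].
have := polyarc_affine 0 h20 p1.
rewrite !subr0 mul0r => /(@polyarc_eq _ _ _ gamma) q1.
have {}q1 : polyarc g 0 (1 / 2) gamma L1.
  by apply: q1 => t; rewrite in_itv/= /gamma => /andP[_ ->].
have := polyarc_affine (- 1) h20 p2.
rewrite opprK add0r => /(@polyarc_eq _ _ _ gamma) q2.
have {}q2 : polyarc g (1 / 2) 1 gamma L2.
  rewrite (_ : (1 + 1) / 2 = 1) in q2; last by lra.
  apply: q2 => t; rewrite in_itv/= /gamma => /andP[t1 t2].
  case: ifP => // t3; have -> : t = 1 / 2 by apply/eqP; rewrite eq_le t3.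
  by rewrite addr0 mulrC divfK// subrr g11 g20.
have gam0 : gamma 0 = x by rewrite /gamma divr_ge0//= mulr0 addr0.
have gam1 : gamma 1 = z.
  rewrite /gamma (_ : (1 <= 1 / 2 :> R) = false); last first.
    by apply/negbTE; rewrite -ltNge ltr_pdivrMr// mul1r ltr1n.
  by rewrite mulr1 (_ : 2 + -1 = 1 :> R)//; lra.
have := polyarc_distance (polyarc_cat q1 q2).
rewrite gam0 gam1 => /le_trans; apply; rewrite -EFinD lee_fin.
by clear -L1r L2r; lra.
Qed.

End polyarc_theory.

(** * First-order behaviour of the distance *)

(** Compare with the length of the straight segment from [u] to [u'], along
    which the metric is close to its value at [x]. *)
Lemma distance_near (R : realType) (n : nat) (M : smoothManifoldType R n)
    (g : riemannian_metric M) (x : M) (e : R) : 0 < e ->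
  exists2 d : R, 0 < d & forall u u' : 'rV[R]_n,
    `|u - chart_at x x| < d -> `|u' - chart_at x x| < d ->
    (riemannian_distance g (chart_inv (chart_at x) u) (chart_inv (chart_at x) u')
       <= (tnorm g x (u' - u) + e * `|u' - u|)%:E)%E.
Proof.
move=> e0; set c := chart_at x.
have ac : atlas c := chart_at_atlas x.
have [d1 d10 d1P] := tnorm_near g x e0.
have [d2 d20 d2P] := chart_img_near (chart_at_dom x).
exists (Num.min d1 d2); first by rewrite lt_min d10.
move=> u u' ud u'd; set w := u' - u.
pose A (t : R) := u + t *: w.
have cA : continuous A.
  by move=> t; apply: cvgD; [exact: cvg_cst|apply: cvgZr_tmp; exact: cvg_id].
pose U := [set t | chart_img c (A t)].
have oU : open U by have := (continuousP _).1 cA _ (@chart_img_open _ _ _ c).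
have Ad t : 0 <= t <= 1 -> `|A t - c x| < Num.min d1 d2.
  move=> /andP[t0 t1].
  have -> : A t - c x = (1 - t) *: (u - c x) + t *: (u' - c x).
    by rewrite /A /w; apply/rowP => i; rewrite !mxE; ring.
  rewrite (le_lt_trans (ler_normD _ _))// !normrZ !ger0_norm ?subr_ge0//.
  move: t0; rewrite le_eqVlt => /predU1P[<-|t0].
    by rewrite subr0 mul1r mul0r addr0.
  have -> : Num.min d1 d2 = (1 - t) * Num.min d1 d2 + t * Num.min d1 d2 by ring.
  by rewrite ler_ltD ?ltr_pM2l// ler_wpM2l ?subr_ge0 ?(ltW ud).
have sU : `[0, 1] `<=` U.
  move=> t /=; rewrite in_itv/= => /Ad; rewrite lt_min => /andP[_]; exact: d2P.
pose delta t := chart_inv c (A t).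
have cd t : U t -> {for t, continuous delta}.
  move=> Ut; apply: continuous_comp; first exact: cA.
  exact: chart_inv_continuous.
have lL : linear (fun t : R => t *: w).
  by move=> k s t; rewrite scalerDl scalerA.
pose L : {linear R -> 'rV[R]_n} := HB.pack (fun t : R => t *: w)
  (GRing.isLinear.Build R R 'rV[R]_n _ _ lL).
have dL t : U t -> strict_diff (c \o delta) t L.
  move=> Ut; have H : strict_diff A t L.
    apply: strict_diff_shift; apply: (@strict_diff_lin _ _ _ L t (`|w| + 1)).
      by rewrite ltr_wpDl.
    by move=> s /=; rewrite normrZ mulrC ler_wpM2r// lerDl.
  apply: strict_diff_near_eq H.
  have [r r0 rU] := near_norm_lt (open_nbhs_nbhs (conj oU Ut)).
  by apply: (norm_lt_near r0) => s /rU Us; rewrite /delta /= chart_invK.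
have C1d : C1_curve_on U delta.
  apply: C1_curve_onI => // t Ut; split; first exact: cd.
  exists c; split=> //; first exact: chart_inv_dom.
  by exists L; exact: dL.
have d0E : delta 0 = chart_inv c u by rewrite /delta /A scale0r addr0.
have d1E : delta 1 = chart_inv c u' by rewrite /delta /A scale1r /w addrC subrK.
rewrite -d0E -d1E.
apply: (le_trans (polyarc_distance (polyarc_arc g ltr01 oU sU C1d))).
rewrite lee_fin.
have <- : \int[lebesgue_measure]_(t in `[0, 1]) (tnorm g x w + e * `|w|) =
    tnorm g x w + e * `|w|.
  by rewrite Rintegral_cst//= lebesgue_measure_itv/= lte_fin ltr01 sube0 mulr1.
apply: le_Rintegral => //.
- exact: arc_integrable oU C1d sU.
- apply: continuous_compact_integrable; first exact: segment_compact.
  exact/continuous_subspaceT/cst_continuous.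
- move=> t /= /[dup] t01 /sU Ut; move: t01; rewrite in_itv/= => /Ad.
  rewrite lt_min => /andP[At1 _].
  rewrite (speed_of_coordinates g (cd t Ut) ac (chart_inv_dom Ut) (dL t Ut)).
  have [] := d1P (delta t) (chart_inv_dom Ut) _ (L 1).
    by rewrite -/c /delta chart_invK.
  by rewrite /= scale1r.
Qed.

Lemma distance_dominated (R : realType) (n : nat) (M : smoothManifoldType R n)
    (g : riemannian_metric M) : dominated g (riemannian_distance g).
Proof.
move=> x e e0; have [d d0 dP] := distance_near g x e0.
exists d => // y cy v vd.
have cx0 : `|chart_at x x - chart_at x x| < d by rewrite subrr normr0.
have := dP _ _ cx0 vd; have := dP _ _ vd cx0.
rewrite (chart_mapK (chart_at_dom x)) (chart_mapK cy) => H1 H2; split=> //.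
by move: H1; rewrite -(opprB (chart_at x y)) tnormN normrN.
Qed.

Lemma distance_le0 (R : realType) (n : nat) (M : smoothManifoldType R n)
    (g : riemannian_metric M) (x : M) : (riemannian_distance g x x <= 0)%E.
Proof. by apply: dominated_refl; exact: distance_dominated. Qed.

(** No curve is reversed: being dominated is a symmetric condition, so the
    comparison principle applies to the transposed distance. *)
Lemma distance_sym (R : realType) (n : nat) (M : smoothManifoldType R n)
    (g : riemannian_metric M) (x y : M) :
  riemannian_distance g x y = riemannian_distance g y x.
Proof.
suff H z t : (riemannian_distance g z t <= riemannian_distance g t z)%E.
  by apply/eqP; rewrite eq_le !H.
apply: (@dominated_le_distance _ _ _ g (fun a b => riemannian_distance g b a)).
  by move=> a b c r s ab bc; rewrite addrC; exact: distance_triangular bc ab.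
move=> a e e0; have [d d0 dP] := @distance_dominated _ _ _ g a e e0.
by exists d => // b ab /= /(dP b ab)[].
Qed.

(** The comparison principle for the distance between images, which to first
    order is the norm of the image of a tangent vector. *)
Lemma distance_nonexpansive (R : realType) (m n : nat)
    (M : smoothManifoldType R m) (N : smoothManifoldType R n)
    (g : riemannian_metric M) (h : riemannian_metric N) (f : M -> N) :
  continuous f ->
  (forall x, exists2 L : {linear 'rV[R]_m -> 'rV[R]_n},
     strict_diff (chart_at (f x) \o f \o chart_inv (chart_at x)) (chart_at x x) L &
     forall v, tnorm h (f x) (L v) <= tnorm g x v) ->
  forall x y, (riemannian_distance h (f x) (f y) <= riemannian_distance g x y)%E.
Proof.
move=> cf fL x0 y0.
apply: (@dominated_le_distance _ _ _ g (fun a b => riemannian_distance h (f a) (f b))).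
  by move=> a b c r s; exact: distance_triangular.
move=> x e e0; have [L [[KL KL0 LK] LP] Lg] := fL x.
set c := chart_at x; set c' := chart_at (f x).
have [K K0 HK] := tnorm_le h (f x).
pose e2 := e / 2 / (KL + 1).
have KL1 : 0 < KL + 1 by rewrite addr_gt0.
have e20 : 0 < e2 by rewrite !divr_gt0.
have [d1 d10 d1P] := @distance_dominated _ _ _ h (f x) e2 e20.
pose e3 := Num.min 1 (e / 2 / K).
have e30 : 0 < e3 by rewrite lt_min ltr01 !divr_gt0.
have [d2 d20 d2P] := LP e3 e30.
have [d3 d30 d3P] : exists2 d : R, 0 < d & forall u, `|u - c x| < d ->
    chart_dom c' (f (chart_inv c u)).
  apply: near_norm_lt.
  have cu : {for c x, continuous (f \o chart_inv c)}.
    apply: continuous_comp; last exact: cf.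
    by apply: chart_inv_continuous; apply: chart_img_map; exact: chart_at_dom.
  apply: cu; rewrite /= chart_mapK; last exact: chart_at_dom.
  by apply: open_nbhs_nbhs; split; [exact: chart_dom_open|exact: chart_at_dom].
pose d4 := d1 / (KL + 1).
have d40 : 0 < d4 by rewrite divr_gt0.
exists (Num.min d2 (Num.min d3 d4)); first by rewrite !lt_min d20 d30.
move=> y cy v; rewrite !lt_min => /and3P[vd2 vd3 vd4].
have := d2P (c y) (c x) vd2; rewrite subrr normr0 => /(_ d20).
rewrite /= (chart_mapK cy) (chart_mapK (chart_at_dom x)) -/v -/c' => A.
have := d3P (c y) vd3; rewrite chart_mapK// => fy.
set r := c' (f y) - c' (f x) in A *.
have rv : `|r| <= (KL + 1) * `|v|.
  rewrite -[r](subrK (L v)) (le_trans (ler_normD _ _))// addrC mulrDl lerD ?LK//.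
  by rewrite (le_trans A)// ler_wpM2r// ge_min lexx.
have rd : `|r| < d1.
  by rewrite (le_lt_trans rv)// mulrC -ltr_pdivlMr.
have tr : tnorm h (f x) r <= tnorm g x v + e / 2 * `|v|.
  rewrite -[r](subrK (L v)) (le_trans (tnormD _ _ _ _))// addrC lerD ?Lg//.
  rewrite (le_trans (HK _))//.
  apply: (@le_trans _ _ (K * (e / 2 / K * `|v|))).
    rewrite ler_wpM2l ?(ltW K0)// (le_trans A)// ler_wpM2r// ge_min lexx orbT//.
  by rewrite mulrA (mulrC K) divfK ?gt_eqF.
have er : e2 * `|r| <= e / 2 * `|v|.
  apply: (@le_trans _ _ (e2 * ((KL + 1) * `|v|))).
    by rewrite ler_wpM2l// ltW.
  by rewrite mulrA /e2 divfK// gt_eqF.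
have fin : tnorm h (f x) r + e2 * `|r| <= tnorm g x v + e * `|v|.
  apply: (le_trans (lerD tr er)); rewrite -addrA -mulrDl -splitr//.
have [B1 B2] := d1P _ fy rd.
by split; [apply: le_trans B1 _|apply: le_trans B2 _]; rewrite lee_fin.
Qed.

(** By the triangle inequality it is enough that the distance to [y] is small
    near [y], which is what domination says. *)
Lemma open_ball_open (R : realType) (n : nat) (M : smoothManifoldType R n)
    (g : riemannian_metric M) (x : M) (r : R) :
  open [set y | (riemannian_distance g x y < r%:E)%E].
Proof.
rewrite openE => y /= xyr.
have [s xys sr] : exists2 s : R, (riemannian_distance g x y <= s%:E)%E & s < r.
  have [gamma [L [pL g0 g1 Lr]]] := distance_polyarc xyr.
  by exists L => //; rewrite -g0 -g1; exact: polyarc_distance.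
have [d d0 dP] := @distance_dominated _ _ _ g y 1 ltr01.
have [K K0 HK] := tnorm_le g y.
set c := chart_at y; have cy : chart_dom c y := chart_at_dom y.
pose d' := Num.min d ((r - s) / (K + 1)).
have K1 : 0 < K + 1 by rewrite addr_gt0.
have d'0 : 0 < d' by rewrite lt_min d0 divr_gt0// subr_gt0.
have : nbhs y (chart_dom c `&` [set z | `|c z - c y| < d']).
  apply: filterI; first by apply: open_nbhs_nbhs; split=> //; exact: chart_dom_open.
  have cc : c z @[z --> y] --> c y by exact: (chart_map_continuous cy).
  by near=> z; rewrite /= distrC; near: z; exact: cvgr_dist_lt.
apply: filterS => z [cz]; rewrite /= lt_min => /andP[zd zr].
have [yz _] := dP z cz zd.
apply: le_lt_trans (distance_triangular xys yz) _; rewrite lte_fin mul1r.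
have : tnorm g y (c z - c y) + `|c z - c y| <= (K + 1) * `|c z - c y|.
  by rewrite mulrDl mul1r lerD2r.
have : (K + 1) * `|c z - c y| < r - s by rewrite mulrC -ltr_pdivlMr.
by rewrite -/c; move: (tnorm _ _ _) => a b cc; clear -b cc; lra.
Unshelve. all: by end_near. Qed.

Lemma cball_measurable (R : realType) (n : nat) (M : smoothManifoldType R n)
    (g : riemannian_metric M) (x : M) (r : R) :
  measurable (cball (riemannian_distance g) x r : set (borelType M)).
Proof.
have -> : cball (riemannian_distance g) x r =
    \bigcap_i [set y | (riemannian_distance g x y < (r + i.+1%:R^-1)%:E)%E].
  apply/seteqP; split=> [y xy i _|y xy].
    by rewrite /= (le_lt_trans xy)// lte_fin ltrDl.
  apply/lee_addgt0Pr => e e0.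
  have [i ie] := ltr_add_invr (e0 : 0 < e).
  apply/ltW; apply: (lt_trans (xy i I)).
  by rewrite -EFinD lte_fin ltrD2l; rewrite add0r in ie.
apply: bigcap_measurable => // i _.
by apply: sub_sigma_algebra; exact: open_ball_open.
Qed.

(** Let [psi] be the coordinate distance to [x], cut off at [rho].  For a small
    constant [k] the two-point function [k / 2 * |psi y - psi z|] is dominated by
    the metric, so that points outside the coordinate ball of radius [rho], where
    [psi = rho], are at a positive distance from [x]. *)
Lemma small_ball_compact (R : realType) (n : nat) (M : smoothManifoldType R n)
    (g : riemannian_metric M) (x : M) :
  exists2 r : R, 0 < r & exists2 K : set M, compact K &
    cball (riemannian_distance g) x r `<=` K.
Proof.
set c := chart_at x; have cx : chart_dom c x := chart_at_dom x.
have ac : atlas c := chart_at_atlas x.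
have [k k0 Hk] := tnorm_ge g x.
have k20 : 0 < k / 2 by rewrite divr_gt0.
have [d1 d10 d1P] := tnorm_near g x k20.
have [d2 d20 d2P] := chart_img_near cx.
pose m := Num.min d1 d2.
have m0 : 0 < m by rewrite lt_min d10.
pose rho := m / 2.
have rho0 : 0 < rho by rewrite divr_gt0.
have rhom : rho < m by rewrite /rho ltr_pdivrMr// ltr_pMr// ltr1n.
pose D := [set u : 'rV[R]_n | `|u - c x| <= rho].
have Dimg u : D u -> chart_img c u.
  by move=> Du; apply: d2P; rewrite (le_lt_trans Du)// (lt_le_trans rhom)// ge_min lexx orbT.
have cD : compact D.
  apply: bounded_closed_compact.
    exists (`|c x| + rho); split; first exact: num_real.
    move=> r rr u Du; rewrite /= -[u](subrK (c x)) (le_trans (ler_normD _ _))//.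
    by apply/ltW/(le_lt_trans _ rr); rewrite addrC lerD2l.
  apply: (@closed_comp _ _ (fun u : 'rV[R]_n => `|u - c x|) [set s | s <= rho]).
    move=> u _; apply: continuous_comp; last exact: norm_continuous.
    by apply/continuous_norm_ltP => r r0; exists r => // y; rewrite opprB addrA subrK.
  exact: closed_le.
pose V := chart_inv c @` D.
have cV : compact V.
  apply: continuous_compact => //; apply: continuous_in_subspaceT => u.
  by rewrite inE => /Dimg; exact: chart_inv_continuous.
have clV : closed V := compact_closed (@manifold_hausdorff _ _ M) cV.
pose psi y := if pselect (V y) then `|c y - c x| else rho.
have psiE y : chart_dom c y -> psi y = Num.min rho `|c y - c x|.
  move=> cy; rewrite /psi; case: pselect => /= [[u Du uy]|nV].
    by rewrite -uy chart_invK; [rewrite min_r|exact: Dimg].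
  rewrite min_l// leNgt; apply/negP => /ltW Dy; apply: nV.
  by exists (c y) => //; rewrite chart_mapK.
have psi_lip y z : chart_dom c y -> chart_dom c z -> `|psi y - psi z| <= `|c y - c z|.
  move=> cy cz; rewrite !psiE//.
  have H (a b : R) : `|Num.min rho a - Num.min rho b| <= `|a - b|.
    by rewrite !minEle; case: ifP => ha; case: ifP => hb;
      rewrite ?subrr ?normr0//; move: ha hb => /idP ha /idP hb;
      rewrite ler_norml; apply/andP; split; have := ler_norm (a - b);
      have := ler_norm (b - a); rewrite (distrC b);
      move: ha hb; rewrite ?(rwP negP) -?ltNge => ? ?; lra.
  apply: (le_trans (H _ _)).
  by rewrite (le_trans (ler_dist_dist _ _))// opprB addrA subrK.
pose E y z := (k / 2 * `|psi y - psi z|)%:E.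
have tE : triangular E.
  move=> y z t r s; rewrite /E !lee_fin => yz zt.
  rewrite -(subrKA (psi z)) (le_trans _ (lerD yz zt))// -mulrDr ler_wpM2l ?(ltW k20)//.
  exact: ler_normD.
have dE : dominated g E.
  move=> y e e0; set c' := chart_at y.
  have ac' : atlas c' := chart_at_atlas y.
  have c'y : chart_dom c' y := chart_at_dom y.
  have [Vy|nVy] := pselect (V y); last first.
    have [d d0 dP] : exists2 d : R, 0 < d & forall u, `|u - c' y| < d ->
        ~ V (chart_inv c' u).
      apply: near_norm_lt; have cu := chart_inv_continuous (chart_img_map c'y).
      apply: (cu (~` V)); rewrite (chart_mapK c'y); apply: open_nbhs_nbhs; split=> //.
      exact: closed_openC.
    exists d => // z c'z v vd; have := dP _ vd; rewrite (chart_mapK c'z) => nVz.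
    have E0 a b : ~ V a -> ~ V b -> E a b = 0%E.
      move=> nVa nVb; rewrite /E /psi.
      case: (pselect (V a)) => //= ?; case: (pselect (V b)) => //= ?.
      by rewrite subrr normr0 mulr0.
    by rewrite !E0// lee_fin addr_ge0 ?tnorm_ge0// mulr_ge0// ltW.
  have [cy yrho] : chart_dom c y /\ `|c y - c x| <= rho.
    case: Vy => u Du <-; split; first exact/chart_inv_dom/Dimg.
    by rewrite chart_invK//; exact: Dimg.
  have yd1 : `|c y - c x| < d1.
    by rewrite (le_lt_trans yrho)// (lt_le_trans rhom)// ge_min lexx.
  have [T TL] := transition_strict_diff ac' ac c'y cy.
  pose e1 := e / (k / 2).
  have e10 : 0 < e1 by rewrite divr_gt0.
  have [d3 d30 d3P] := TL.2 e1 e10.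
  have [d4 d40 d4P] : exists2 d : R, 0 < d & forall u, `|u - c' y| < d ->
      chart_dom c (chart_inv c' u).
    apply: near_norm_lt; have cu := chart_inv_continuous (chart_img_map c'y).
    apply: cu; rewrite (chart_mapK c'y); apply: open_nbhs_nbhs; split=> //.
    exact: chart_dom_open.
  exists (Num.min d3 d4); first by rewrite lt_min d30.
  move=> z c'z v; rewrite lt_min => /andP[vd3 vd4].
  have cz : chart_dom c z by have := d4P _ vd4; rewrite (chart_mapK c'z).
  have := d3P _ (c' y) vd3; rewrite subrr normr0 => /(_ d30).
  rewrite /= (chart_mapK c'z) (chart_mapK c'y) -/v => A.
  have B : k / 2 * `|T v| <= tnorm g y v.
    have [_] := d1P y cy yd1 (T v).
    rewrite -/c (of_coordinates_transition v ac cy TL).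
    by have := Hk (T v); move: (tnorm g x _) (tnorm g y _) `|T v| => a b t; clear; lra.
  have C : `|c z - c y| <= `|T v| + e1 * `|v|.
    by rewrite -[c z - c y](subrK (T v)) (le_trans (ler_normD _ _))// addrC lerD2l.
  have : k / 2 * `|psi y - psi z| <= tnorm g y v + e * `|v|.
    apply: (@le_trans _ _ (k / 2 * (`|T v| + e1 * `|v|))).
      by rewrite ler_wpM2l ?(ltW k20)// (le_trans (psi_lip _ _ cy cz))// distrC.
    have e1E : k / 2 * e1 = e by rewrite /e1 mulrC divfK// gt_eqF.
    by rewrite mulrDr mulrA e1E lerD.
  by rewrite /E (distrC (psi z)) lee_fin.
exists (k / 4 * rho); first by rewrite mulr_gt0// divr_gt0.
exists V => // y xy.
have := @dominated_le_distance _ _ _ g E x y tE dE.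
move=> /le_trans /(_ xy).
have -> : E x y = (k / 2 * psi y)%:E.
  rewrite /E psiE// subrr normr0 min_r ?(ltW rho0)// sub0r normrN ger0_norm//.
  by rewrite /psi; case: (pselect (V y)) => //= ?; exact: ltW.
rewrite lee_fin; rewrite /psi; case: (pselect (V y)) => //= ? H; exfalso.
move: (mulr_gt0 k0 rho0) H; clear; move: rho => r; lra.
Qed.

(** * Riemannian submersions *)

Lemma posdef_unitmx (R : realType) (n : nat) (Q : 'M[R]_n) :
  (forall v : 'rV[R]_n, v != 0 -> 0 < (v *m Q *m v^T) ord0 ord0) ->
  Q \in unitmx.
Proof.
move=> Q0; rewrite -row_free_unit; apply: inj_row_free => v vQ.
apply/eqP; apply: contraT => /Q0; by rewrite vQ mul0mx mxE ltxx.
Qed.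

(** The weighted pseudo-inverse [(A^T Q^-T A)^-1 A^T Q^-T] is the right inverse
    of [A] whose values are orthogonal to the kernel for the inner product [Q]. *)
Lemma horizontal_right_inverse (R : realType) (n k : nat) (Q : 'M[R]_n)
    (A : 'M[R]_(n, k)) :
  (forall v : 'rV[R]_n, v != 0 -> 0 < (v *m Q *m v^T) ord0 ord0) ->
  (forall w : 'rV[R]_k, exists v, v *m A = w) ->
  exists S : 'M[R]_(k, n), S *m A = 1%:M /\
    forall (u : 'rV[R]_n) (w : 'rV[R]_k), u *m A = 0 -> u *m Q *m (w *m S)^T = 0.
Proof.
move=> Q0 Asurj.
have Qu : Q \in unitmx := posdef_unitmx Q0.
have QTu : Q^T \in unitmx by rewrite unitmx_tr.
have QT0 (z : 'rV[R]_n) : z *m Q^T *m z^T = 0 -> z = 0.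
  move=> H; apply/eqP; apply: contraT => /Q0.
  have -> : z *m Q *m z^T = (z *m Q^T *m z^T)^T.
    by rewrite !trmx_mul !trmxK mulmxA.
  by rewrite H trmx0 mxE ltxx.
pose B := A^T *m invmx Q^T *m A.
have Bu : B \in unitmx.
  rewrite -row_free_unit; apply: inj_row_free => w wB.
  pose z := w *m A^T *m invmx Q^T.
  have zA : z *m A = 0 by rewrite /z -wB /B !mulmxA.
  have zQ : z *m Q^T = w *m A^T by rewrite /z mulmxKV.
  have z0 : z = 0.
    by apply: QT0; rewrite zQ -mulmxA -trmx_mul zA trmx0 mulmx0.
  have wA : w *m A^T = 0 by rewrite -zQ z0 mul0mx.
  have [v vA] := Asurj w.
  have : (w *m w^T) ord0 ord0 = 0.
    by rewrite -{2}vA trmx_mul mulmxA wA mul0mx mxE.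
  rewrite mxE => /eqP; rewrite psumr_eq0; last first.
    by move=> i _; rewrite mxE -expr2 sqr_ge0.
  move=> /allP H; apply/rowP => i; have := H i (mem_index_enum i).
  by rewrite !mxE /= -expr2 sqrf_eq0 => /eqP.
exists (invmx B *m A^T *m invmx Q^T); split.
  by rewrite -!mulmxA (mulmxA A^T) mulVmx.
move=> u w uA; rewrite !trmx_mul trmxK !mulmxA trmx_inv trmxK.
by rewrite mulmxK// uA !mul0mx.
Qed.

Lemma submersion_lift (R : realType) (m k : nat) (G : smoothManifoldType R m)
    (M : smoothManifoldType R k) (g : riemannian_metric G)
    (h : riemannian_metric M) (f : G -> M) (t : G) :
  riemannian_submersion g h f ->
  exists S : 'M[R]_(k, m), [/\ forall w, differential f t (w *m S) = w,
    forall w, horizontal f g t (w *m S) &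
    forall w, tnorm g t (w *m S) = tnorm h (f t) w].
Proof.
move=> [sf [fsurj fiso]].
have [L fL LE] := differential_strict_diff t sf.
have [||S [SA SQ]] := @horizontal_right_inverse R m k (gram g t) (lin1_mx L).
- by move=> v; exact: (inner_pos g t).
- by move=> w; have [v vw] := fsurj t w; exists v; rewrite mul_rV_lin1 -LE.
have S1 w : differential f t (w *m S) = w.
  by rewrite LE -mul_rV_lin1 -mulmxA SA mulmx1.
have S2 w : horizontal f g t (w *m S).
  move=> u fu; rewrite /inner SQ ?mxE// mul_rV_lin1 -LE//.
exists S; split=> // w.
by rewrite /tnorm -(fiso t _ _ (S2 w) (S2 w)) S1.
Qed.

(** Pythagoras: [v] differs from the horizontal lift of its image by a vector
    of the kernel. *)
Lemma submersion_tnorm_le (R : realType) (m k : nat) (G : smoothManifoldType R m)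
    (M : smoothManifoldType R k) (g : riemannian_metric G)
    (h : riemannian_metric M) (f : G -> M) (t : G) (v : 'rV[R]_m) :
  riemannian_submersion g h f ->
  tnorm h (f t) (differential f t v) <= tnorm g t v.
Proof.
move=> sub; have [S [S1 S2 S3]] := submersion_lift t sub.
have [L fL LE] := differential_strict_diff t sub.1.
set w := differential f t v.
have ker : differential f t (v - w *m S) = 0.
  by rewrite LE linearB -!LE S1 subrr.
rewrite -S3; apply: ler_wsqrtr.
have -> : inner g t v v = inner g t (v - w *m S) (v - w *m S) +
    inner g t (w *m S) (w *m S).
  rewrite -{1 2}(subrK (w *m S) v) !(innerDl g t _ (w *m S)) !(innerDr g t _ (w *m S)).
  by rewrite (inner_sym g t (w *m S) (v - _)) (S2 w _ ker) addr0 add0r.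
by rewrite lerDr inner_ge0.
Qed.

Lemma submersion_nonexpansive (R : realType) (m k : nat)
    (G : smoothManifoldType R m) (M : smoothManifoldType R k)
    (g : riemannian_metric G) (h : riemannian_metric M) (f : G -> M) :
  riemannian_submersion g h f ->
  forall s t, (riemannian_distance h (f s) (f t) <= riemannian_distance g s t)%E.
Proof.
move=> sub; apply: distance_nonexpansive; first by case: sub => [[]].
move=> x; have [L fL LE] := differential_strict_diff x sub.1.
by exists L => // v; rewrite -LE; exact: submersion_tnorm_le.
Qed.

Definition fiber_distance {R : realType} {S T : Type} (d : S -> S -> \bar R)
    (f : S -> T) (x y : T) : \bar R :=
  ereal_inf [set r | exists s t, [/\ f s = x, f t = y & r = d s t]].

Lemma fiber_distance_le {R : realType} {S T : Type} (d : S -> S -> \bar R)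
    (f : S -> T) (s t : S) : (fiber_distance d f (f s) (f t) <= d s t)%E.
Proof. by apply: ereal_inf_lbound; exists s, t. Qed.

Lemma fiber_distance_lt {R : realType} {S T : Type} (d : S -> S -> \bar R)
    (f : S -> T) (x y : T) (r : \bar R) : (fiber_distance d f x y < r)%E ->
  exists s t, [/\ f s = x, f t = y & (d s t < r)%E].
Proof. by move=> /ereal_inf_lt[_ [s [t [fs ft ->]]] ?]; exists s, t. Qed.

(** The hypothesis on fibres lets one move the second of two nearly optimal
    pairs of points so that it starts where the first one ends. *)
Lemma fiber_distance_triangular (R : realType) (S T : Type)
    (d : S -> S -> \bar R) (f : S -> T) :
  triangular d ->
  (forall t t' s, f t = f t' -> exists2 s', f s' = f s & (d t s' <= d t' s)%E) ->
  triangular (fiber_distance d f).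
Proof.
move=> dd tr x y z r s xy yz; apply/lee_addgt0Pr => e e0.
have e20 : 0 < e / 2 by rewrite divr_gt0.
have [|a [b [ax yb ab]]] := @fiber_distance_lt R S T d f x y (r + e / 2)%:E.
  by rewrite (le_lt_trans xy)// lte_fin ltrDl.
have [|b' [c [b'y cz bc]]] := @fiber_distance_lt R S T d f y z (s + e / 2)%:E.
  by rewrite (le_lt_trans yz)// lte_fin ltrDl.
have [|c' c'c bc'] := tr b b' c; first by rewrite yb b'y.
have H := dd a b c' _ _ (ltW ab) (le_trans bc' (ltW bc)).
rewrite -ax -cz -c'c (le_trans (fiber_distance_le _ _ _ _))// (le_trans H)//.
by rewrite -EFinD lee_fin; clear; lra.
Qed.

(** Infinitesimal lifting: near [f t], the point with coordinate increment [v]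
    is the image of a point near [t] whose increment is the horizontal lift of
    a vector [w] close to [v]; no horizontal curve has to be integrated. *)
Lemma fiber_distance_dominated (R : realType) (m k : nat)
    (G : smoothManifoldType R m) (M : smoothManifoldType R k)
    (g : riemannian_metric G) (h : riemannian_metric M) (f : G -> M) :
  riemannian_submersion g h f -> (forall x, exists t, f t = x) ->
  dominated h (fiber_distance (riemannian_distance g) f).
Proof.
move=> sub fsurj x e e0; have [t ft] := fsurj x; rewrite -ft => {x ft}.
have [S [S1 _ S3]] := submersion_lift t sub.
have [L fL LE] := differential_strict_diff t sub.1.
set c := chart_at t in fL *; set c' := chart_at (f t) in fL *.
have ct : chart_dom c t := chart_at_dom t.
have c't : chart_dom c' (f t) := chart_at_dom (f t).
have [KS KS0 HS] := mulmx_norm_le S.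
have [K K0 HK] := tnorm_le h (f t).
pose A (w : 'rV[R]_k) : 'rV[R]_m := c t + w *m S.
pose F := (c' \o f \o chart_inv c) \o A.
have dA : strict_diff A 0 (mulmxr S).
  by apply: strict_diff_shift; apply: (@strict_diff_lin _ _ _ (mulmxr S) 0 KS).
have A0 : A 0 = c t by rewrite /A mul0mx addr0.
have dF : strict_diff F 0 idfun.
  have dF' : strict_diff F 0 (L \o mulmxr S).
    by apply: strict_diff_comp dA _; rewrite A0.
  have [_ H] := dF'; split.
    by exists 1 => // v; rewrite mul1r.
  by move=> r /H[d d0 dP]; exists d => // y z yd zd; have := dP y z yd zd;
    rewrite /= -LE S1.
have F0 : F 0 = c' (f t) by rewrite /F /= A0 chart_mapK.
(* [e1] bounds the relative error of the lift, [e2] that of the distance upstairs. *)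
pose e1 := Num.min 1 (e / 2 / K).
have e10 : 0 < e1 by rewrite lt_min ltr01 !divr_gt0.
pose e2 := e / 2 / (2 * KS).
have e20 : 0 < e2 by rewrite !divr_gt0// mulr_gt0.
have [d1 d10 d1P] := strict_diff_local_surj dF e10.
have [d2 d20 d2P] := @distance_near _ _ _ g t e2 e20.
have [d3 d30 d3P] : exists2 d : R, 0 < d & forall u, `|u - c t| < d ->
    chart_dom c' (f (chart_inv c u)).
  apply: near_norm_lt.
  have cu : {for c t, continuous (f \o chart_inv c)}.
    apply: continuous_comp; last by case: sub => [[cf _] _]; exact: cf.
    by apply: chart_inv_continuous; apply: chart_img_map.
  apply: cu; rewrite /= (chart_mapK ct).
  by apply: open_nbhs_nbhs; split; [exact: chart_dom_open|].
pose d4 := Num.min d2 d3 / (2 * KS).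
have d40 : 0 < d4 by rewrite divr_gt0 ?mulr_gt0// lt_min d20.
exists (Num.min d1 d4); first by rewrite lt_min d10.
move=> y c'y v; rewrite lt_min => /andP[vd1 vd4].
have [|w Fw wv] := d1P (c' y); first by rewrite F0.
rewrite F0 -/v in wv.
have w2 : `|w| <= 2 * `|v|.
  rewrite -[w](subrK v) (le_trans (ler_normD _ _))// mulrDl mul1r lerD2r.
  by rewrite (le_trans wv)// ler_piMl// ge_min lexx.
have wS : `|w *m S| <= 2 * KS * `|v|.
  by rewrite (le_trans (HS _))// mulrAC mulrC ler_wpM2r// ltW.
have wSd : `|A w - c t| < Num.min d2 d3.
  rewrite /A addrAC subrr add0r (le_lt_trans wS)// mulrC -ltr_pdivlMr//.
  by rewrite mulr_gt0.
move: (wSd); rewrite lt_min => /andP[wd2 wd3].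
pose s := chart_inv c (A w).
have fs : f s = y.
  by rewrite -(chart_mapK c'y) -Fw /F /= chart_mapK//; exact: d3P.
have tw : tnorm g t (w *m S) <= tnorm h (f t) v + e / 2 * `|v|.
  rewrite S3 -[w](subrK v) (le_trans (tnormD _ _ _ _))// addrC lerD2l.
  rewrite (le_trans (HK _))//.
  apply: (@le_trans _ _ (K * (e / 2 / K * `|v|))).
    by rewrite ler_wpM2l ?(ltW K0)// (le_trans wv)// ler_wpM2r// ge_min lexx orbT.
  by rewrite mulrA (mulrC K) divfK ?gt_eqF.
have ew : e2 * `|w *m S| <= e / 2 * `|v|.
  apply: (@le_trans _ _ (e2 * (2 * KS * `|v|))).
    by rewrite ler_wpM2l// ltW.
  by rewrite mulrA /e2 divfK// gt_eqF// mulr_gt0.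
have ts : (riemannian_distance g t s <= (tnorm h (f t) v + e * `|v|)%:E)%E.
  have ct0 : `|c t - c t| < d2 by rewrite subrr normr0.
  have := d2P _ _ ct0 wd2; rewrite -/c (chart_mapK ct) => /le_trans; apply.
  rewrite lee_fin /A addrAC subrr add0r.
  by apply: (le_trans (lerD tw ew)); rewrite -addrA -mulrDl -splitr.
rewrite -fs; split; apply: le_trans (fiber_distance_le _ _ _ _) _ => //.
by rewrite distance_sym.
Qed.

(** * Left-invariant metrics on Lie groups *)

Lemma continuous_mulgl (R : realType) (n : nat) (G : lieGroupType R n) (a : G) :
  continuous (fun y : G => (a * y)%g).
Proof.
have [cm _] := @mul_smooth R n G; move=> y.
apply: (@continuous_comp _ _ _ (fun y : G => (a, y)) (fun z : G * G => (z.1 * z.2)%g)).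
  by apply: cvg_pair; [exact: cvg_cst|exact: cvg_id].
exact: cm.
Qed.

Lemma continuous_mulgr (R : realType) (n : nat) (G : lieGroupType R n) (a : G) :
  continuous (fun y : G => (y * a)%g).
Proof.
have [cm _] := @mul_smooth R n G; move=> y.
apply: (@continuous_comp _ _ _ (fun y : G => (y, a)) (fun z : G * G => (z.1 * z.2)%g)).
  by apply: cvg_pair; [exact: cvg_id|exact: cvg_cst].
exact: cm.
Qed.

Lemma left_mul_strict_diff (R : realType) (n : nat) (G : lieGroupType R n)
    (a x : G) :
  exists L : {linear 'rV[R]_n -> 'rV[R]_n},
    strict_diff (chart_at (a * x)%g \o (fun y : G => (a * y)%g) \o
      chart_inv (chart_at x)) (chart_at x x) L.
Proof.
have [_ sm] := @mul_smooth R n G.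
set c := chart_at a; set d := chart_at x; set e := chart_at (a * x)%g.
have ca : chart_dom c a := chart_at_dom a.
have dx : chart_dom d x := chart_at_dom x.
have := sm c d e (chart_at_atlas _) (chart_at_atlas _) (chart_at_atlas _) 1%N.
move=> /(@Ck1_slice _ _ _ _ _ _ (c a)) /=; rewrite (chart_mapK ca) => H.
apply: (@C1_strict_diff _ _ _
  (chart_img d `&` [set w | chart_dom e (a * chart_inv d w)%g])).
- apply: (@open_setI_preimage _ _ (fun w => (a * chart_inv d w)%g)).
  + exact: chart_img_open.
  + exact: chart_dom_open.
  + move=> w dw; apply: continuous_comp; first exact: chart_inv_continuous.
    exact: continuous_mulgl.
- have -> : chart_img d `&` [set w | chart_dom e (a * chart_inv d w)%g] =
      (fun w => (chart_img c (c a) /\ chart_img d w) /\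
        chart_dom e (a * chart_inv d w)%g).
    apply/seteqP; split=> w /=; last by move=> [[_ ?] ?].
    by move=> [? ?]; split=> //; split=> //; exact: chart_img_map.
  exact: H.
- split; first exact: chart_img_map.
  by rewrite /= (chart_mapK dx); exact: chart_at_dom.
Qed.

Section left_invariant.
Context {R : realType} {n : nat} {G : lieGroupType R n}.
Variable g : riemannian_metric G.
Hypothesis g_left : left_invariant_metric g.
Local Notation d := (riemannian_distance g).

Lemma distance_mulgl (a x y : G) : d (a * x)%g (a * y)%g = d x y.
Proof.
suff H b s t : (d (b * s)%g (b * t)%g <= d s t)%E.
  apply/eqP; rewrite eq_le H/=.
  by have := H (a^-1)%g (a * x)%g (a * y)%g; rewrite !mulKg.
apply: (@distance_nonexpansive _ _ _ _ _ g g (fun y => (b * y)%g)).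
  exact: continuous_mulgl.
move=> z; have [L zL] := left_mul_strict_diff b z; exists L => // v.
have fv := strict_diff_is_derive v zL.
have Lv : L v = differential (fun y : G => (b * y)%g) z v.
  by rewrite /differential (@derive_val _ _ _ _ _ _ _ fv).
by rewrite Lv /tnorm g_left.
Qed.

Lemma distance1V (a : G) : d 1%g (a^-1)%g = d 1%g a.
Proof. by rewrite -(distance_mulgl a) mulg1 mulgV distance_sym. Qed.

Lemma distance1M (a b : G) (r s : R) : (d 1%g a <= r%:E)%E -> (d 1%g b <= s%:E)%E ->
  (d 1%g (a * b)%g <= (r + s)%:E)%E.
Proof.
move=> ar bs; apply: distance_triangular ar _.
by rewrite -{1}(mulg1 a) distance_mulgl.
Qed.

End left_invariant.

(** * Borel measures and quotients of measures *)

Lemma open_borel (T : ptopologicalType) (U : set T) :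
  open U -> measurable (U : set (borelType T)).
Proof. by move=> oU; apply: sub_sigma_algebra. Qed.

Lemma closed_borel (T : ptopologicalType) (V : set T) :
  closed V -> measurable (V : set (borelType T)).
Proof.
move=> cV; rewrite -(setCK V); apply: (@measurableC _ (borelType T)).
by apply: open_borel; rewrite openC.
Qed.

Lemma continuous_borel_preimage (S T : ptopologicalType) (f : S -> T) (A : set T) :
  continuous f -> measurable (A : set (borelType T)) ->
  measurable (f @^-1` A : set (borelType S)).
Proof.
move=> cf mA.
have mf : measurable_fun setT (f : borelType S -> borelType T).
  apply: (@measurability _ _ (borelType S) (borelType T) setT f (@open T)) => // _ [U oU <-].
  rewrite setTI; apply: open_borel; exact: (continuousP _).1 cf _ oU.
by rewrite -[X in measurable X]setTI; exact: mf.
Qed.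

Lemma measure_bigcup_seq_le (R : realType) (T : ptopologicalType) (I : Type)
    (mu : {measure set (borelType T) -> \bar R}) (s : seq I) (F : I -> set T)
    (b : \bar R) :
  (forall i, measurable (F i : set (borelType T))) ->
  (forall i, (mu (F i) <= b)%E) -> (0 <= b)%E ->
  measurable (\big[setU/set0]_(i <- s) F i : set (borelType T)) /\
  (mu (\big[setU/set0]_(i <- s) F i) <= (size s)%:R%:E * b)%E.
Proof.
move=> mF Fb b0; elim: s => [|i s [ms IH]].
  by rewrite big_nil measure0 mul0e; split=> //; exact: measurable0.
rewrite big_cons; split; first exact: measurableU.
apply: le_trans (measureU2 mu (mF i) ms) _.
rewrite /= -natr1 EFinD ge0_muleDl ?lee_fin// mul1e addeC.
exact: leeD.
Qed.

Lemma ediv_le (R : realType) (a b : \bar R) (C : R) :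
  (0 <= a)%E -> (0 <= b)%E -> 0 <= C -> (a <= C%:E * b)%E -> (a / b <= C%:E)%E.
Proof.
move=> a0; case: b => [b| |]// b0 C0.
- move: b0; rewrite lee_fin le_eqVlt => /predU1P[<-|b0].
    rewrite mule0 => a0'; have -> : a = 0%E by apply/eqP; rewrite eq_le a0' a0.
    by rewrite mul0e lee_fin.
  by rewrite inver gt_eqF// lee_pdivrMr.
- by rewrite invey mule0 lee_fin.
Qed.

Lemma ediv_ge (R : realType) (a b : \bar R) (C : R) :
  (0 < b)%E -> (b < +oo)%E -> (a / b <= C%:E)%E -> (a <= C%:E * b)%E.
Proof.
case: b => [b| |]//; rewrite lte_fin => b0 _.
by rewrite inver gt_eqF// lee_pdivrMr.
Qed.

(** * Balls in the group *)

Section group_balls.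
Context {R : realType} {n : nat} {G : lieGroupType R n}.
Variable mu : {measure set (borelType G) -> \bar R}.
Hypothesis mu_haar : bi_invariant_haar mu.
Variable g : riemannian_metric G.
Hypothesis g_left : left_invariant_metric g.
Local Notation d := (riemannian_distance g).
Local Notation B := (cball d 1%g).

Lemma gball_measurable r : measurable (B r : set (borelType G)).
Proof. exact: cball_measurable. Qed.

Lemma gball_le r s : r <= s -> (mu (B r) <= mu (B s))%E.
Proof.
move=> rs; apply: le_measure; rewrite ?inE; try exact: gball_measurable.
by move=> y /le_trans; apply; rewrite lee_fin.
Qed.

(** Finitely many translates of a ball cover any compact set, so a ball of
    measure zero would make the inner regular measure [mu] vanish. *)
Lemma gball_gt0 r : 0 < r -> (0 < mu (B r))%E.
Proof.
move=> r0; rewrite lt0e measure_ge0 andbT; apply/negP => /eqP B0.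
have [[[_ [_ mu_inner]] [muG mu_left]] _] := mu_haar.
pose U a : set G := [set y | (d a y < r%:E)%E].
have oU a : open (U a) := open_ball_open g a r.
have U1 : mu (U 1%g) = 0%E.
  apply/eqP; rewrite eq_le measure_ge0 andbT -B0.
  apply: le_measure; rewrite ?inE; [exact: open_borel|exact: gball_measurable|].
  by move=> y /ltW.
have U0 a : mu (U a) = 0%E.
  rewrite -U1 -(mu_left a (U 1%g)); last exact: open_borel.
  congr (mu _); apply/seteqP; split=> [y ay|_ [z z1 <-]].
    exists (a^-1 * y)%g; last by rewrite mulVKg.
    by rewrite /U/= -(distance_mulgl g_left a) mulg1 mulVKg.
  by move: z1; rewrite /U/= -(distance_mulgl g_left a) mulg1.
apply: muG; rewrite mu_inner; last exact: openT.
apply/eqP; rewrite eq_le; apply/andP; split; last first.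
  apply: ereal_sup_ubound; exists set0; last by rewrite measure0.
  by split=> //; exact: compact0.
apply: ge_ereal_sup => _ [K [cK _] <-].
move: (cK); rewrite compact_cover => /(_ G setT U).
case=> [|y _|D' _ KD].
- by move=> a _; exact: oU.
- by exists y => //; rewrite /U/=; apply: le_lt_trans (distance_le0 _ _) _; rewrite lte_fin.
have mU a : measurable (U a : set (borelType G)) := open_borel (oU a).
have U0le a : (mu (U a) <= 0)%E by rewrite U0.
have [ms ms0] := @measure_bigcup_seq_le _ _ _ mu (finmap.enum_fset D') U 0%E mU
  U0le (lexx _).
rewrite mule0 in ms0; apply: le_trans ms0.
apply: le_measure; rewrite ?inE//.
- by apply: closed_borel; apply: compact_closed cK; exact: manifold_hausdorff.
- move=> y /KD [a /= aD Uay]; rewrite -bigcup_seq; exists a => //.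
Qed.

Lemma gball_lty_small : exists2 r, 0 < r & (mu (B r) < +oo)%E.
Proof.
have [r r0 [K cK BK]] := small_ball_compact g 1%g.
exists r => //; have [[[mu_fin _] _] _] := mu_haar.
apply: le_lt_trans (mu_fin K cK); apply: le_measure; rewrite ?inE//.
- exact: gball_measurable.
- by apply: closed_borel; apply: compact_closed cK; exact: manifold_hausdorff.
Qed.

Variable C : R.
Hypothesis C_doubling : (doubling_constant d mu <= C%:E)%E.

Lemma gball_ratio r : 0 < r -> (mu (B (2 * r)) / mu (B r) <= C%:E)%E.
Proof.
move=> r0; apply: le_trans C_doubling; apply: ereal_sup_ubound.
by exists 1%g, r.
Qed.

(** A quotient with infinite denominator is 0, so the doubling hypothesis says
    nothing about balls of infinite measure; it does propagate finiteness from
    the small balls of [gball_lty_small] to all balls. *)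
Lemma gball_lty r : (mu (B r) < +oo)%E.
Proof.
have [r0 r00 r0y] := gball_lty_small.
have H j : (mu (B (2 ^+ j * r0)) < +oo)%E.
  elim: j => [|j IH]; first by rewrite expr0 mul1r.
  have p : 0 < 2 ^+ j * r0 by rewrite mulr_gt0// exprn_gt0.
  have := ediv_ge (gball_gt0 p) IH (gball_ratio p).
  rewrite mulrA -exprS => /le_lt_trans; apply.
  have : mu (B (2 ^+ j * r0)) \is a fin_num by rewrite ge0_fin_numE.
  by move=> /fineK <-; rewrite -EFinM ltry.
have [j rj] : exists j, r <= 2 ^+ j * r0.
  have [j jr] : exists j : nat, r / r0 < j%:R.
    exists (Num.trunc `|r / r0|).+1.
    by rewrite (le_lt_trans (ler_norm _))// truncnS_gt.
  exists j; rewrite -ler_pdivrMr//; apply: (le_trans (ltW jr)).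
  by rewrite -natrX ler_nat ltnW// ltn_expl.
exact: le_lt_trans (gball_le rj) (H j).
Qed.

Lemma gball_doubling r : 0 < r -> (mu (B (2 * r)) <= C%:E * mu (B r))%E.
Proof.
by move=> r0; apply: ediv_ge (gball_ratio r0); [exact: gball_gt0|exact: gball_lty].
Qed.

Lemma doubling_ge0 : 0 <= C.
Proof.
have := le_trans (gball_le (ler_peMl ler01 (ler1n _ 2))) (gball_doubling ltr01).
have : mu (B 1) \is a fin_num by rewrite ge0_fin_numE ?gball_lty.
have := gball_gt0 ltr01; case: (mu (B 1)) => // b; rewrite lte_fin => b0 _.
by rewrite -EFinM lee_fin -ler_pdivrMr// divff ?gt_eqF// => /(le_trans ler01).
Qed.

Lemma gball_doubling_iter j r : 0 < r ->
  (mu (B (2 ^+ j * r)) <= (C ^+ j)%:E * mu (B r))%E.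
Proof.
move=> r0; elim: j => [|j IH]; first by rewrite !expr0 mul1r mul1e.
have p : 0 < 2 ^+ j * r by rewrite mulr_gt0// exprn_gt0.
rewrite exprS -mulrA (le_trans (gball_doubling p))// exprS EFinM -muleA.
by rewrite lee_wpmul2l// lee_fin doubling_ge0.
Qed.

(** * Packing right translates *)

Definition rball (s : R) (t : G) : set G := [set y | (d 1%g (y * t^-1)%g <= s%:E)%E].

Lemma rball_measurable s t : measurable (rball s t : set (borelType G)).
Proof.
apply: (@continuous_borel_preimage G G (fun y => (y * t^-1)%g) (B s)).
  exact: continuous_mulgr.
exact: gball_measurable.
Qed.

Lemma measure_rball s t : mu (rball s t) = mu (B s).
Proof.
have [_ mu_right] := mu_haar; rewrite -(mu_right t (B s)); last exact: gball_measurable.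
congr (mu _); apply/seteqP; split=> [y yt|_ [z z1 <-]].
  by exists (y * t^-1)%g => //; rewrite mulgVK.
by rewrite /rball/= mulgK.
Qed.

(** Pairwise disjointness, in a recursive form suited to adding one translate
    at a time. *)
Fixpoint packing (s : R) (l : seq G) : Prop :=
  if l is t :: l' then
    rball s t `&` \big[setU/set0]_(u <- l') rball s u = set0 /\ packing s l'
  else True.

Lemma measure_packing s l : packing s l ->
  measurable (\big[setU/set0]_(u <- l) rball s u : set (borelType G)) /\
  (mu (\big[setU/set0]_(u <- l) rball s u) = (size l)%:R%:E * mu (B s))%E.
Proof.
elim: l => [_|t l IH [tl /IH[ml El]]].
  by rewrite big_nil measure0 mul0e; split=> //; exact: measurable0.
rewrite big_cons; split; first by apply: measurableU => //; exact: rball_measurable.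
have -> : mu (rball s t `|` \big[setU/set0]_(u <- l) rball s u) =
    (mu (rball s t) + mu (\big[setU/set0]_(u <- l) rball s u))%E.
  by apply: measureU => //; exact: rball_measurable.
rewrite measure_rball El /= -natr1 EFinD ge0_muleDl ?lee_fin//.
by rewrite mul1e addeC.
Qed.

(** Take a maximal family of disjoint right translates of [B s] with centres in
    [B (8 s)].  Its size is bounded by comparing volumes; by maximality the
    translate centred at any [t] of [B (8 s)] meets a member of the family, so
    that [t] lies in the translate of [B (2 s)] with the same centre. *)
Lemma ball_covering s : 0 < s -> exists l : seq G,
  (size l)%:R <= C ^+ 4 /\ forall t, (d 1%g t <= (8 * s)%:E)%E ->
    exists2 u, u \in l & (d 1%g (t * u^-1)%g <= (2 * s)%:E)%E.
Proof.
move=> s0.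
pose good l := packing s l /\ forall t, t \in l -> (d 1%g t <= (8 * s)%:E)%E.
have bound l : good l -> (size l)%:R <= C ^+ 4.
  move=> [pl lB]; have [ml El] := measure_packing pl.
  (* The translates lie in [B (9 s)]; 16 is the next power of 2. *)
  have sub : \big[setU/set0]_(u <- l) rball s u `<=` B (2 ^+ 4 * s).
    rewrite -bigcup_seq => y [t /= tl ty].
    rewrite /cball/= -[y](mulgVK t).
    apply: le_trans (distance1M g_left ty (lB t tl)) _.
    rewrite lee_fin (_ : s + 8 * s = 9 * s); last by ring.
    by rewrite ler_wpM2r ?(ltW s0)// -natrX ler_nat.
  have : (mu (\big[setU/set0]_(u <- l) rball s u) <= mu (B (2 ^+ 4 * s)))%E.
    by apply: le_measure; rewrite ?inE//; exact: gball_measurable.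
  move=> /le_trans /(_ (gball_doubling_iter 4 s0)); rewrite El.
  have : mu (B s) \is a fin_num by rewrite ge0_fin_numE ?gball_lty.
  have := gball_gt0 s0; case: (mu (B s)) => // b; rewrite lte_fin => b0 _.
  by rewrite -!EFinM lee_fin ler_pM2r.
pose full l := forall t, (d 1%g t <= (8 * s)%:E)%E ->
  rball s t `&` \big[setU/set0]_(u <- l) rball s u !=set0.
have [l gl fl] : exists2 l, good l & full l.
  apply: contrapT => nofull.
  have grow N : exists2 l, good l & size l = N.
    elim: N => [|N [l gl lN]]; first by exists [::].
    have /existsNP[t /not_implyP[tB /set0P/negP/negPn/eqP tl]] : ~ full l.
      by move=> fl; apply: nofull; exists l.
    exists (t :: l); last by rewrite /= lN.
    case: gl => pl lB; split=> // u; rewrite inE => /predU1P[->//|]; exact: lB.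
  have [l gl lN] := grow (Num.trunc (C ^+ 4)).+1.
  by have := bound l gl; rewrite leNgt lN truncnS_gt.
exists l; split; first exact: bound.
move=> t tB; have [y [yt]] := fl t tB.
rewrite -bigcup_seq => -[u /= ul yu]; exists u => //.
have -> : (t * u^-1 = (y * t^-1)^-1 * (y * u^-1))%g.
  by rewrite invgM invgK -mulgA mulKg.
have -> : 2 * s = s + s by rewrite mulrDl mul1r.
by apply: distance1M => //; rewrite distance1V.
Qed.

End group_balls.

(** * Homogeneous spaces *)

Section homogeneous_space.
Context {R : realType} {n k : nat} {G : lieGroupType R n}
  {M : smoothManifoldType R k}.
Variables (act : M -> G -> M) (p : M).
Hypothesis act_smooth : smooth_right_action act.
Hypothesis act_transitive : transitive_action act.
Variables (g : riemannian_metric G) (h : riemannian_metric M).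
Hypothesis g_left : left_invariant_metric g.
Hypothesis gh : riemannian_submersion g h (act p).
Local Notation dG := (riemannian_distance g).
Local Notation dM := (riemannian_distance h).

Lemma continuous_act (a : G) : continuous (act^~ a).
Proof.
have [_ [_ [ca _]]] := act_smooth; move=> y.
apply: (@continuous_comp _ _ _ (fun y : M => (y, a)) (fun z : M * G => act z.1 z.2)).
  by apply: cvg_pair; [exact: cvg_id|exact: cvg_cst].
exact: ca.
Qed.

Lemma actK (x : M) (a : G) : act (act x a) (a^-1)%g = x.
Proof. by have [a1 [aM _]] := act_smooth; rewrite -aM mulgV a1. Qed.

Lemma actVK (x : M) (a : G) : act (act x (a^-1)%g) a = x.
Proof. by have [a1 [aM _]] := act_smooth; rewrite -aM mulVg a1. Qed.

(** The triangle inequality between fibres holds because left translations by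
    the stabiliser of [p] are isometries, transitive on each fibre. *)
Lemma fiber_distance_le_distance (x y : M) :
  (fiber_distance dG (act p) x y <= dM x y)%E.
Proof.
have [_ [aM _]] := act_smooth.
apply: (@dominated_le_distance _ _ _ h); last exact: fiber_distance_dominated.
apply: fiber_distance_triangular; first exact: distance_triangular.
move=> t t' s tt'; exists (t * t'^-1 * s)%g.
  by rewrite !aM tt' actK.
rewrite -{1}(mulgVK t' t) -mulgA -mulgA.
by rewrite !(distance_mulgl g_left).
Qed.

Lemma act_ball (x : M) (a : G) (r : R) :
  (dG 1%g a <= r%:E)%E -> (dM x (act x a) <= r%:E)%E.
Proof.
have [_ [aM _]] := act_smooth; have [s <-] := act_transitive p x.
move=> ar; rewrite -aM; apply: le_trans (submersion_nonexpansive gh _ _) _.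
by rewrite -{1}(mulg1 s) (distance_mulgl g_left).
Qed.

(** The strict inequality [r < s] absorbs the possible failure of the infimum
    over the fibres to be attained. *)
Lemma ball_act (x y : M) (r s : R) : r < s -> (dM x y <= r%:E)%E ->
  exists2 a, act x a = y & (dG 1%g a <= s%:E)%E.
Proof.
have [_ [aM _]] := act_smooth; move=> rs xy.
have [|t [u [tx uy tu]]] := @fiber_distance_lt R G M dG (act p) x y s%:E.
  by apply: le_lt_trans (fiber_distance_le_distance x y) _; rewrite (le_lt_trans xy)// lte_fin.
exists (t^-1 * u)%g; first by rewrite aM -tx actK.
by rewrite -(distance_mulgl g_left t) mulg1 mulVKg ltW.
Qed.

Variable nu : {measure set (borelType M) -> \bar R}.
Hypothesis nu_invariant : invariant_measure act nu.

Lemma act_image_measurable (A : set M) (a : G) :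
  measurable (A : set (borelType M)) ->
  measurable ([set act x a | x in A] : set (borelType M)).
Proof.
move=> mA; have -> : [set act x a | x in A] = (act^~ (a^-1)%g) @^-1` A.
  apply/seteqP; split=> [_ [x Ax <-]|x Ax]; first by rewrite /= actK.
  by exists (act x (a^-1)%g) => //; rewrite actVK.
by apply: continuous_borel_preimage => //; exact: continuous_act.
Qed.

Variables (mu : {measure set (borelType G) -> \bar R}) (C : R).
Hypothesis mu_haar : bi_invariant_haar mu.
Hypothesis C_doubling : (doubling_constant dG mu <= C%:E)%E.

(** Cover the ball of radius [2 r] around [x] by the translates, under the
    points [t] of a covering of [B (4 r)] in [G], of the ball of radius [r];
    they all have the same measure by invariance of [nu]. *)
Lemma doubling_constant_quotient : (doubling_constant dM nu <= (C ^+ 4)%:E)%E.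
Proof.
have [_ [aM _]] := act_smooth.
apply: ge_ereal_sup => _ [x [r [r0 ->]]].
(* With [s = r / 2] one has [2 s = r], and [8 s = 4 r] exceeds [2 r]. *)
have r20 : 0 < r / 2 by rewrite divr_gt0.
have [l [lC cov]] := ball_covering mu_haar g_left C_doubling r20.
pose F (t : G) := [set act y t | y in cball dM x r].
have mF t : measurable (F t : set (borelType M)).
  by apply: act_image_measurable; exact: cball_measurable.
have nuF t : (nu (F t) <= nu (cball dM x r))%E.
  by rewrite nu_invariant//; exact: cball_measurable.
have [mU nuU] := measure_bigcup_seq_le l mF nuF (measure_ge0 _ _).
have sub : cball dM x (2 * r) `<=` \big[setU/set0]_(t <- l) F t.
  move=> y xy; have r24 : 2 * r < 8 * (r / 2).
    by rewrite [X in _ < X](_ : _ = 4 * r) ?ltr_pM2r ?ltr_nat//; field.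
  have [a <- a4] := ball_act r24 xy.
  have [t tl at_] := cov a a4.
  rewrite -bigcup_seq; exists t => //; exists (act x (a * t^-1)%g).
    by apply: act_ball; rewrite mulrC divfK// in at_.
  by rewrite aM actVK.
apply: ediv_le; rewrite ?measure_ge0//.
  by rewrite exprn_even_ge0.
apply: (@le_trans _ _ (nu (\big[setU/set0]_(t <- l) F t))).
  by apply: le_measure; rewrite ?inE//; exact: cball_measurable.
by apply: (le_trans nuU); rewrite lee_wpmul2r// lee_fin.
Qed.

End homogeneous_space.

Theorem corollary2p6 (R : realType) (n k : nat)
    (G : lieGroupType R n) (M : smoothManifoldType R k)
    (act : M -> G -> M) (nu : {measure set (borelType M) -> \bar R}) (p : M)
    (G_connected : connected [set: G])
    (G_unimodular : unimodular G)
    (act_smooth : smooth_right_action act)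
    (act_transitive : transitive_action act)
    (nu_radon : radon_measure nu)
    (nu_neq0 : nu [set: M] <> 0%E)
    (nu_invariant : invariant_measure act nu)
    (G_doubling : uniformly_doubling_group G) :
  uniformly_doubling
    [set (riemannian_distance h, nu) | h in
      [set h : riemannian_metric M |
        exists g : riemannian_metric G, left_invariant_metric g /\
          riemannian_submersion g h (fun sigma : G => act p sigma)]].
Proof.
have [mu [mu_haar [C HC]]] := G_doubling.
exists (C ^+ 4) => _ [h [g [g_left gh]] <-] /=.
apply: (doubling_constant_quotient act_smooth act_transitive g_left gh
  nu_invariant mu_haar).
by apply: (HC (riemannian_distance g, mu)); exists g.
Qed.
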